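(* Let $G$ be a finite group, $\tau$ an automorphism of $G$ with $\tau^2=\mathrm{id}$, $m$ a natural number, and let $\mathcal{C}$ be a spherical quadratic category with $(G,\tau,m)$. If $|G|$ is odd and $m$ is odd, then $G$ is abelian and $g^\tau=g^{-1}$ for every $g\in G$.
   Context: A fusion category is a rigid semisimple $\mathbb{C}$-linear tensor category with finitely many simple objects up to isomorphism, finite dimensional morphism spaces, and simple unit object $\mathbf{1}$. For such a category $\mathcal{C}$, $\mathcal{O}(\mathcal{C})$ is the set of isomorphism classes of simple objects and $[X]$ is the class of $X$. The isomorphism classes of invertible objects of $\mathcal{C}$ form a finite group $G$; a representative of the class $g\in G$ is denoted by the same letter $g$. $\mathcal{C}$ is a quadratic category with $(G,\tau,m)$, where $\tau$ is an automorphism of $G$ of period two ($g\mapsto g^\tau$, $\tau^2=\mathrm{id}$) and $m$ is a natural number, if there is a self-dual non-invertible simple object $\rho$ such that $\mathcal{O}(\mathcal{C})=G\sqcup\{[g\otimes\rho]\}_{g\in G}$ (the classes $[g\otimes \rho]$ being distinct for distinct $g$) with fusion rules $[g][h]=[gh]$, $[g][\rho]=[\rho][g^\tau]$ for $g,h\in G$, and $[\rho]^2=[\mathbf{1}]+\sum_{g\in G}m[g\otimes\rho]$. *)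

(* Defs.v *)
From mathcomp Require Import all_boot all_algebra all_fingroup.

Set Implicit Arguments.
Unset Strict Implicit.
Unset Printing Implicit Defensive.

Import GRing.Theory.
Local Open Scope ring_scope.

Record lincat (K : fieldType) := LinCat {
  Ob :> Type;
  Mor : Ob -> Ob -> vectType K;
  idmor : forall X, Mor X X;
  comp : forall X Y Z, Mor Y Z -> Mor X Y -> Mor X Z;
  comp_linear_l : forall X Y Z (f : Mor X Y), linear (fun g : Mor Y Z => comp g f);
  comp_linear_r : forall X Y Z (g : Mor Y Z), linear (fun f : Mor X Y => comp g f);
  compA : forall X Y Z W (h : Mor Z W) (g : Mor Y Z) (f : Mor X Y),
    comp h (comp g f) = comp (comp h g) f;
  comp1m : forall X Y (f : Mor X Y), comp (idmor Y) f = f;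
  compm1 : forall X Y (f : Mor X Y), comp f (idmor X) = f
}.
Arguments idmor {K C} X : rename.
Arguments comp {K C X Y Z} g f : rename.

Notation "g ∘ f" := (comp g f) (at level 40, left associativity).

Definition inverse_pair (K : fieldType) (C : lincat K) (X Y : C)
    (f : Mor X Y) (g : Mor Y X) : Prop :=
  g ∘ f = idmor X /\ f ∘ g = idmor Y.

Definition is_iso (K : fieldType) (C : lincat K) (X Y : C) (f : Mor X Y) : Prop :=
  exists g : Mor Y X, inverse_pair f g.

Definition isomorphic (K : fieldType) (C : lincat K) (X Y : C) : Prop :=
  exists f : Mor X Y, is_iso f.

Notation "X ≅ Y" := (isomorphic X Y) (at level 70).

Definition monic (K : fieldType) (C : lincat K) (X Y : C) (f : Mor X Y) : Prop :=
  forall (Z : C) (u v : Mor Z X), f ∘ u = f ∘ v -> u = v.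

Definition epic (K : fieldType) (C : lincat K) (X Y : C) (f : Mor X Y) : Prop :=
  forall (Z : C) (u v : Mor Y Z), u ∘ f = v ∘ f -> u = v.

Definition zero_object (K : fieldType) (C : lincat K) (Z : C) : Prop :=
  forall X : C, (forall f : Mor Z X, f = 0) /\ (forall f : Mor X Z, f = 0).

Definition is_kernel (K : fieldType) (C : lincat K) (X Y N : C)
    (f : Mor X Y) (k : Mor N X) : Prop :=
  f ∘ k = 0 /\
  forall (Z : C) (u : Mor Z X), f ∘ u = 0 -> exists! v : Mor Z N, k ∘ v = u.

Definition is_cokernel (K : fieldType) (C : lincat K) (X Y Q : C)
    (f : Mor X Y) (q : Mor Y Q) : Prop :=
  q ∘ f = 0 /\
  forall (Z : C) (u : Mor Y Z), u ∘ f = 0 -> exists! v : Mor Q Z, v ∘ q = u.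

(** [S] is a direct sum of the finite family [X] (a zero object if [I] is empty). *)
Definition is_direct_sum (K : fieldType) (C : lincat K) (I : finType)
    (X : I -> C) (S : C) : Prop :=
  exists (inj : forall i, Mor (X i) S) (proj : forall i, Mor S (X i)),
    [/\ forall i, proj i ∘ inj i = idmor (X i),
        forall i j, i != j -> proj j ∘ inj i = 0
      & \sum_(i : I) inj i ∘ proj i = idmor S].

Definition is_abelian (K : fieldType) (C : lincat K) : Prop :=
  [/\ exists Z : C, zero_object Z,
      forall X Y : C, exists S : C, is_direct_sum (fun b : bool => if b then X else Y) S,
      forall (X Y : C) (f : Mor X Y),
        (exists (N : C) (k : Mor N X), is_kernel f k) /\
        (exists (Q : C) (q : Mor Y Q), is_cokernel f q),
      forall (X Y : C) (f : Mor X Y), monic f ->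
        exists (Z : C) (g : Mor Y Z), is_kernel g f
    & forall (X Y : C) (f : Mor X Y), epic f ->
        exists (Z : C) (g : Mor Z X), is_cokernel g f].

Definition simple_object (K : fieldType) (C : lincat K) (X : C) : Prop :=
  ~ zero_object X /\
  forall (Y : C) (f : Mor Y X), monic f -> zero_object Y \/ is_iso f.

Definition is_semisimple (K : fieldType) (C : lincat K) : Prop :=
  forall X : C, exists (n : nat) (F : 'I_n -> C),
    (forall i, simple_object (F i)) /\ is_direct_sum F X.

Definition finitely_many_simples (K : fieldType) (C : lincat K) : Prop :=
  exists (n : nat) (F : 'I_n -> C),
    forall X : C, simple_object X -> exists i, X ≅ F i.

Record moncat (K : fieldType) := MonCat {
  moncat_lincat :> lincat K;
  unitob : moncat_lincat;
  tens : moncat_lincat -> moncat_lincat -> moncat_lincat;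
  tensm : forall X X' Y Y' : moncat_lincat,
    Mor X X' -> Mor Y Y' -> Mor (tens X Y) (tens X' Y');
  tensm_linear_l : forall (X X' Y Y' : moncat_lincat) (g : Mor Y Y'),
    linear (fun f : Mor X X' => tensm f g);
  tensm_linear_r : forall (X X' Y Y' : moncat_lincat) (f : Mor X X'),
    linear (fun g : Mor Y Y' => tensm f g);
  tensm_id : forall X Y : moncat_lincat, tensm (idmor X) (idmor Y) = idmor (tens X Y);
  tensm_comp : forall (X X' X'' Y Y' Y'' : moncat_lincat)
      (f' : Mor X' X'') (f : Mor X X') (g' : Mor Y' Y'') (g : Mor Y Y'),
    tensm (f' ∘ f) (g' ∘ g) = tensm f' g' ∘ tensm f g;
  assoc : forall X Y Z, Mor (tens (tens X Y) Z) (tens X (tens Y Z));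
  assocV : forall X Y Z, Mor (tens X (tens Y Z)) (tens (tens X Y) Z);
  assocK : forall X Y Z, inverse_pair (assoc X Y Z) (assocV X Y Z);
  lunit : forall X, Mor (tens unitob X) X;
  lunitV : forall X, Mor X (tens unitob X);
  lunitK : forall X, inverse_pair (lunit X) (lunitV X);
  runit : forall X, Mor (tens X unitob) X;
  runitV : forall X, Mor X (tens X unitob);
  runitK : forall X, inverse_pair (runit X) (runitV X);
  assoc_nat : forall (X X' Y Y' Z Z' : moncat_lincat)
      (f : Mor X X') (g : Mor Y Y') (h : Mor Z Z'),
    assoc X' Y' Z' ∘ tensm (tensm f g) h = tensm f (tensm g h) ∘ assoc X Y Z;
  lunit_nat : forall (X X' : moncat_lincat) (f : Mor X X'),
    lunit X' ∘ tensm (idmor unitob) f = f ∘ lunit X;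
  runit_nat : forall (X X' : moncat_lincat) (f : Mor X X'),
    runit X' ∘ tensm f (idmor unitob) = f ∘ runit X;
  pentagon : forall X Y Z W : moncat_lincat,
    tensm (idmor X) (assoc Y Z W) ∘ assoc X (tens Y Z) W ∘ tensm (assoc X Y Z) (idmor W)
    = assoc X Y (tens Z W) ∘ assoc (tens X Y) Z W;
  triangle : forall X Y : moncat_lincat,
    tensm (idmor X) (lunit Y) ∘ assoc X unitob Y = tensm (runit X) (idmor Y)
}.
Arguments unitob {K} m.
Arguments tens {K m} X Y : rename.
Arguments tensm {K m X X' Y Y'} f g : rename.
Arguments assoc {K m} X Y Z : rename.
Arguments assocV {K m} X Y Z : rename.
Arguments lunit {K m} X : rename.
Arguments lunitV {K m} X : rename.
Arguments runit {K m} X : rename.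
Arguments runitV {K m} X : rename.

Notation "X ⊗ Y" := (tens X Y) (at level 40, left associativity).
Notation "f ⊠ g" := (tensm f g) (at level 35, right associativity).

Definition invertible (K : fieldType) (C : moncat K) (X : C) : Prop :=
  exists Y : C, X ⊗ Y ≅ unitob C /\ Y ⊗ X ≅ unitob C.

(** [Y], with evaluation [ev] and coevaluation [coev], is a left dual of [X]
    (equivalently, [X] is a right dual of [Y]). *)
Definition duality (K : fieldType) (C : moncat K) (X Y : C)
    (ev : Mor (Y ⊗ X) (unitob C)) (coev : Mor (unitob C) (X ⊗ Y)) : Prop :=
  runit X ∘ (idmor X ⊠ ev) ∘ assoc X Y X ∘ (coev ⊠ idmor X) ∘ lunitV X = idmor X /\
  lunit Y ∘ (ev ⊠ idmor Y) ∘ assocV Y X Y ∘ (idmor Y ⊠ coev) ∘ runitV Y = idmor Y.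

Record rigidcat (K : fieldType) := RigidCat {
  rigidcat_moncat :> moncat K;
  dual : rigidcat_moncat -> rigidcat_moncat;
  ev : forall X, Mor (dual X ⊗ X) (unitob rigidcat_moncat);
  coev : forall X, Mor (unitob rigidcat_moncat) (X ⊗ dual X);
  dualP : forall X, duality (ev X) (coev X);
  right_dual_exists : forall X : rigidcat_moncat,
    exists (Y : rigidcat_moncat) (e : Mor (X ⊗ Y) (unitob rigidcat_moncat))
           (c : Mor (unitob rigidcat_moncat) (Y ⊗ X)), duality e c
}.
Arguments dual {K r} X : rename.
Arguments ev {K r} X : rename.
Arguments coev {K r} X : rename.

(** The morphism [Z -> dual X] corresponding to a pairing [Z ⊗ X -> 1]. *)
Definition transpose (K : fieldType) (C : rigidcat K) (Z X : C)
    (e : Mor (Z ⊗ X) (unitob C)) : Mor Z (dual X) :=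
  lunit (dual X) ∘ (e ⊠ idmor (dual X)) ∘ assocV Z X (dual X)
    ∘ (idmor Z ⊠ coev X) ∘ runitV Z.

Definition dualm (K : fieldType) (C : rigidcat K) (X Y : C) (f : Mor X Y) :
    Mor (dual Y) (dual X) :=
  transpose (ev Y ∘ (idmor (dual Y) ⊠ f)).

(** The transpose of the pairing
    [(dual Y ⊗ dual X) ⊗ (X ⊗ Y) -> dual Y ⊗ (dual X ⊗ (X ⊗ Y))
       -> dual Y ⊗ Y -> unitob C]. *)
Definition dual_tens (K : fieldType) (C : rigidcat K) (X Y : C) :
    Mor (dual Y ⊗ dual X) (dual (X ⊗ Y)) :=
  transpose
    (ev Y ∘ (idmor (dual Y) ⊠ (lunit Y ∘ (ev X ⊠ idmor Y) ∘ assocV (dual X) X Y))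
       ∘ assoc (dual Y) (dual X) (X ⊗ Y)).

Definition dual_one (K : fieldType) (C : rigidcat K) : Mor (unitob C) (dual (unitob C)) :=
  transpose (lunit (unitob C)).

(** A monoidal natural isomorphism from the identity to the double dual
    functor. The monoidal structure of the latter is
    [(dualm (dual_tens X Y))^-1 ∘ dual_tens (dual Y) (dual X)] on tensor products
    and [(dualm dual_one)^-1 ∘ dual_one] on the unit; to avoid the inverses, the
    two compatibility conditions are composed with the isomorphisms
    [dualm (dual_tens X Y)] and [dualm dual_one]. *)
Record pivotal_structure (K : fieldType) (C : rigidcat K) := PivotalStructure {
  piv : forall X : C, Mor X (dual (dual X));
  pivV : forall X : C, Mor (dual (dual X)) X;
  pivK : forall X, inverse_pair (piv X) (pivV X);
  piv_nat : forall (X Y : C) (f : Mor X Y), piv Y ∘ f = dualm (dualm f) ∘ piv X;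
  piv_tens : forall X Y : C,
    dualm (dual_tens X Y) ∘ piv (X ⊗ Y)
    = dual_tens (dual Y) (dual X) ∘ (piv X ⊠ piv Y);
  piv_one : dualm (dual_one C) ∘ piv (unitob C) = dual_one C
}.
Arguments piv {K C} p X : rename.
Arguments pivV {K C} p X : rename.

Definition right_trace (K : fieldType) (C : rigidcat K) (p : pivotal_structure C)
    (X : C) (f : Mor X X) : Mor (unitob C) (unitob C) :=
  ev (dual X) ∘ ((piv p X ∘ f) ⊠ idmor (dual X)) ∘ coev X.

Definition left_trace (K : fieldType) (C : rigidcat K) (p : pivotal_structure C)
    (X : C) (f : Mor X X) : Mor (unitob C) (unitob C) :=
  ev X ∘ (idmor (dual X) ⊠ (f ∘ pivV p X)) ∘ coev (dual X).

Definition is_spherical (K : fieldType) (C : rigidcat K) (p : pivotal_structure C) :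
    Prop :=
  forall (X : C) (f : Mor X X), left_trace p f = right_trace p f.

Definition is_fusion (K : fieldType) (C : rigidcat K) : Prop :=
  [/\ is_abelian C, is_semisimple C, finitely_many_simples C
    & simple_object (unitob C)].

(** [inv g] is a representative of the isomorphism class [g]. *)
Definition is_group_of_invertibles (K : fieldType) (C : moncat K)
    (G : finGroupType) (inv : G -> C) : Prop :=
  [/\ forall g, invertible (inv g),
      forall X : C, invertible X -> exists g, X ≅ inv g,
      forall g h, inv g ≅ inv h -> g = h
    & forall g h, inv g ⊗ inv h ≅ inv (g * h)%g].

(** Identities [[X][Y] = sum_Z N_Z [Z]] between classes are read as direct sum
    decompositions. In that of [rho ⊗ rho], the index [None] stands for the unit
    object and [Some (g, k)] for the [k]-th copy of [g ⊗ rho]. *)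
Definition is_quadratic (K : fieldType) (C : rigidcat K)
    (G : finGroupType) (tau : G -> G) (m : nat) : Prop :=
  exists (inv : G -> C) (rho : C),
  [/\ is_group_of_invertibles inv,
      [/\ simple_object rho, dual rho ≅ rho & ~ invertible rho],
      [/\ forall g, simple_object (inv g),
          forall g, simple_object (inv g ⊗ rho),
          forall g h, inv g ⊗ rho ≅ inv h ⊗ rho -> g = h,
          forall g h, ~ inv g ≅ inv h ⊗ rho
        & forall X : C, simple_object X ->
            (exists g, X ≅ inv g) \/ (exists g, X ≅ inv g ⊗ rho)],
      forall g, inv g ⊗ rho ≅ rho ⊗ inv (tau g)
    & is_direct_sum
        (fun i : option (G * 'I_m) =>
           if i is Some (g, _) then inv g ⊗ rho else unitob C)
        (rho ⊗ rho)].

(* Main.v *)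
(** Suppose [τ h = h] for some [h ≠ 1]. Let [S_i] run over the simple objects, and
    let [M] be the direct sum of the [S_i ⊗ S_i*]: it represents the functor that
    sends [W] to the natural families of maps [W ⊗ B -> B]. Closing up a strand
    [Y] to the right of [B] (a partial trace) turns such a family into another
    one, so that the Grothendieck ring of the category acts on [M] by
    endomorphisms [T Y]. This is the image in the category of the action on the
    induced object [I(1)] of the Drinfeld center, but the center is not needed.
    The trace of [T Y] vanishes for every simple [Y] other than the unit.

    Let [k] be the order of [h] and [ω ≠ 1] a root of unity with [ω^k = 1]. As
    [h] commutes with [ρ], and as the averaging element of the powers of [h] with
    weights [ω^i] kills the sum of all [g], the fusion rules make
    [(2k)^-1 (sum_i ω^i T(h^i)) (1 + T ρ)] an idempotent. Its trace is
    [(2k)^-1 dim M = n (1 + d^2) / (2k)], where [n = |G|] and [d = dim ρ]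
    satisfies [d^2 = 1 + n m d]. But the trace of an idempotent is the dimension
    of its image, which is [a + b d] with [a] and [b] natural numbers, because
    sphericality forces the invertible objects to have dimension 1. For [n] and
    [m] odd this contradicts parity. So [τ] has no fixed point but [1], hence
    [g |-> g^-1 τ(g)] is onto and [τ] is the inversion. *)

From HB Require Import structures.
From mathcomp Require Import all_boot all_algebra all_fingroup.
From mathcomp Require Import cyclic boolp reals complex.
From mathcomp Require Import zify ring lra.
Require Import Defs.

Set Implicit Arguments.
Unset Strict Implicit.
Unset Printing Implicit Defensive.

Import GRing.Theory Num.Theory.
Local Open Scope ring_scope.

Notation "X ◁ f" := (tensm (idmor X) f) (at level 35, right associativity).
Notation "f ▷ Y" := (tensm f (idmor Y)) (at level 33, left associativity).

(** * Additivity and homogeneity extracted from the predicate [linear] *)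

Section LinearMap.
Context {K : fieldType} {U V : vectType K} {f : U -> V}.
Hypothesis f_lin : linear f.

Lemma linearE0 : f 0 = 0.
Proof. by have := f_lin (-1) 0 0; rewrite scaler0 addr0 scaleN1r addNr. Qed.

Lemma linearED u v : f (u + v) = f u + f v.
Proof. by have := f_lin 1 u v; rewrite !scale1r. Qed.

Lemma linearEZ a u : f (a *: u) = a *: f u.
Proof. by have := f_lin a u 0; rewrite linearE0 !addr0. Qed.

Lemma linearE_sum (I : Type) (r : seq I) (P : pred I) (F : I -> U) :
  f (\sum_(i <- r | P i) F i) = \sum_(i <- r | P i) f (F i).
Proof. exact: (big_morph f linearED linearE0). Qed.

End LinearMap.

(** * Bilinearity of composition and isomorphism of objects *)

Section LinearCategory.
Context {K : fieldType} {C : lincat K}.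
Implicit Types X Y Z W : C.

(* Rewriting rules inside a left-associated chain of compositions. *)
Lemma chain2 X Y Y' Z W (g : Mor Y Z) (f : Mor X Y) (g' : Mor Y' Z)
    (f' : Mor X Y') (x : Mor Z W) :
  g ∘ f = g' ∘ f' -> x ∘ g ∘ f = x ∘ g' ∘ f'.
Proof. by move=> e; rewrite -!compA e. Qed.

Lemma chain1 X Y Z W (g : Mor Y Z) (f : Mor X Y) (h : Mor X Z) (x : Mor Z W) :
  g ∘ f = h -> x ∘ g ∘ f = x ∘ h.
Proof. by move=> e; rewrite -!compA e. Qed.

Lemma chain0 X Y W (g : Mor Y X) (f : Mor X Y) (x : Mor X W) :
  g ∘ f = idmor X -> x ∘ g ∘ f = x.
Proof. by move=> e; rewrite -!compA e compm1. Qed.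

Lemma chain32 X Y Y' Y'' Z W (g : Mor Y'' Z) (f : Mor Y Y'') (e : Mor X Y)
    (g' : Mor Y' Z) (f' : Mor X Y') (x : Mor Z W) :
  g ∘ f ∘ e = g' ∘ f' -> x ∘ g ∘ f ∘ e = x ∘ g' ∘ f'.
Proof. by move=> h; rewrite -!compA -h !compA. Qed.

Lemma comp0m X Y Z (f : Mor X Y) : (0 : Mor Y Z) ∘ f = 0.
Proof. exact: linearE0 (comp_linear_l f). Qed.
Lemma compm0 X Y Z (g : Mor Y Z) : g ∘ (0 : Mor X Y) = 0.
Proof. exact: linearE0 (comp_linear_r g). Qed.
Lemma compDl X Y Z (f : Mor X Y) (g h : Mor Y Z) : (g + h) ∘ f = g ∘ f + h ∘ f.
Proof. exact: linearED (comp_linear_l f) _ _. Qed.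
Lemma compDr X Y Z (g : Mor Y Z) (f h : Mor X Y) : g ∘ (f + h) = g ∘ f + g ∘ h.
Proof. exact: linearED (comp_linear_r g) _ _. Qed.
Lemma compZl X Y Z (f : Mor X Y) a (g : Mor Y Z) : (a *: g) ∘ f = a *: (g ∘ f).
Proof. exact: linearEZ (comp_linear_l f) _ _. Qed.
Lemma compZr X Y Z (g : Mor Y Z) a (f : Mor X Y) : g ∘ (a *: f) = a *: (g ∘ f).
Proof. exact: linearEZ (comp_linear_r g) _ _. Qed.
Lemma compBl X Y Z (f : Mor X Y) (g h : Mor Y Z) : (g - h) ∘ f = g ∘ f - h ∘ f.
Proof. by rewrite compDl -scaleN1r compZl scaleN1r. Qed.
Lemma compBr X Y Z (g : Mor Y Z) (f h : Mor X Y) : g ∘ (f - h) = g ∘ f - g ∘ h.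
Proof. by rewrite compDr -scaleN1r compZr scaleN1r. Qed.
Lemma comp_suml X Y Z (I : Type) (r : seq I) (P : pred I) (F : I -> Mor Y Z)
    (f : Mor X Y) :
  (\sum_(i <- r | P i) F i) ∘ f = \sum_(i <- r | P i) (F i ∘ f).
Proof. exact: linearE_sum (comp_linear_l f) _ _ _ _. Qed.
Lemma comp_sumr X Y Z (I : Type) (r : seq I) (P : pred I) (F : I -> Mor X Y)
    (g : Mor Y Z) :
  g ∘ (\sum_(i <- r | P i) F i) = \sum_(i <- r | P i) (g ∘ F i).
Proof. exact: linearE_sum (comp_linear_r g) _ _ _ _. Qed.

Lemma iso_sym X Y : X ≅ Y -> Y ≅ X.
Proof. by case=> f [g [gf fg]]; exists g, f; split. Qed.

Lemma iso_trans X Y Z : X ≅ Y -> Y ≅ Z -> X ≅ Z.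
Proof.
case=> f [f' [f'f ff']] [g [g' [g'g gg']]]; exists (g ∘ f), (f' ∘ g').
by split; rewrite !compA; [rewrite (chain0 _ g'g) | rewrite (chain0 _ ff')].
Qed.

End LinearCategory.

(** * Coherence in monoidal categories, pairings and copairings *)

Section MonoidalCategory.
Context {K : fieldType} {C : moncat K}.
Implicit Types X Y Z W A B : C.
Local Notation "𝟙" := (unitob C).

Lemma tensDl X X' Y Y' (f g : Mor X X') (h : Mor Y Y') :
  (f + g) ⊠ h = (f ⊠ h) + (g ⊠ h).
Proof. exact: linearED (tensm_linear_l h) _ _. Qed.
Lemma tens0m X X' Y Y' (h : Mor Y Y') : (0 : Mor X X') ⊠ h = 0.
Proof. exact: linearE0 (tensm_linear_l h). Qed.
Lemma tensm0 X X' Y Y' (h : Mor Y Y') : h ⊠ (0 : Mor X X') = 0.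
Proof. exact: linearE0 (tensm_linear_r h). Qed.
Lemma tensZl X X' Y Y' a (f : Mor X X') (h : Mor Y Y') :
  (a *: f) ⊠ h = a *: (f ⊠ h).
Proof. exact: linearEZ (tensm_linear_l h) _ _. Qed.
Lemma tensZr X X' Y Y' a (f : Mor X X') (h : Mor Y Y') :
  h ⊠ (a *: f) = a *: (h ⊠ f).
Proof. exact: linearEZ (tensm_linear_r h) _ _. Qed.
Lemma tens_suml X X' Y Y' (I : Type) (r : seq I) (P : pred I)
    (F : I -> Mor X X') (h : Mor Y Y') :
  (\sum_(i <- r | P i) F i) ⊠ h = \sum_(i <- r | P i) (F i ⊠ h).
Proof. exact: linearE_sum (tensm_linear_l h) _ _ _ _. Qed.
Lemma tens_sumr X X' Y Y' (I : Type) (r : seq I) (P : pred I)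
    (F : I -> Mor X X') (h : Mor Y Y') :
  h ⊠ (\sum_(i <- r | P i) F i) = \sum_(i <- r | P i) (h ⊠ F i).
Proof. exact: linearE_sum (tensm_linear_r h) _ _ _ _. Qed.

Lemma whiskl_comp A X Y Z (g : Mor Y Z) (f : Mor X Y) :
  A ◁ (g ∘ f) = (A ◁ g) ∘ (A ◁ f).
Proof. by rewrite -tensm_comp comp1m. Qed.
Lemma whiskr_comp A X Y Z (g : Mor Y Z) (f : Mor X Y) :
  (g ∘ f) ▷ A = (g ▷ A) ∘ (f ▷ A).
Proof. by rewrite -tensm_comp comp1m. Qed.
Lemma whisk_exchange X X' Y Y' (f : Mor X X') (g : Mor Y Y') :
  (f ▷ Y') ∘ (X ◁ g) = (X' ◁ g) ∘ (f ▷ Y).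
Proof. by rewrite -!tensm_comp !comp1m !compm1. Qed.
Lemma tensm_split X X' Y Y' (f : Mor X X') (g : Mor Y Y') :
  f ⊠ g = (f ▷ Y') ∘ (X ◁ g).
Proof. by rewrite -tensm_comp comp1m compm1. Qed.

Lemma whiskl_inv A X Y (g : Mor Y X) (f : Mor X Y) :
  g ∘ f = idmor X -> (A ◁ g) ∘ (A ◁ f) = idmor _.
Proof. by move=> gf; rewrite -whiskl_comp gf tensm_id. Qed.
Lemma whiskr_inv A X Y (g : Mor Y X) (f : Mor X Y) :
  g ∘ f = idmor X -> (g ▷ A) ∘ (f ▷ A) = idmor _.
Proof. by move=> gf; rewrite -whiskr_comp gf tensm_id. Qed.

Lemma tens_iso X X' Y Y' : X ≅ X' -> Y ≅ Y' -> X ⊗ Y ≅ X' ⊗ Y'.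
Proof.
case=> f [f' [f'f ff']] [g [g' [g'g gg']]]; exists (f ⊠ g), (f' ⊠ g').
by split; rewrite -tensm_comp ?f'f ?ff' ?g'g ?gg' tensm_id.
Qed.

Lemma assoc_assocV X Y Z : assoc X Y Z ∘ assocV X Y Z = idmor _.
Proof. by case: (assocK X Y Z). Qed.
Lemma assocV_assoc X Y Z : assocV X Y Z ∘ assoc X Y Z = idmor _.
Proof. by case: (assocK X Y Z). Qed.
Lemma runit_runitV X : runit X ∘ runitV X = idmor X.
Proof. by case: (runitK X). Qed.
Lemma runitV_runit X : runitV X ∘ runit X = idmor _.
Proof. by case: (runitK X). Qed.
Lemma lunit_lunitV X : lunit X ∘ lunitV X = idmor X.
Proof. by case: (lunitK X). Qed.
Lemma lunitV_lunit X : lunitV X ∘ lunit X = idmor _.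
Proof. by case: (lunitK X). Qed.

Lemma assoc_epi X Y Z W (u v : Mor (X ⊗ (Y ⊗ Z)) W) :
  u ∘ assoc X Y Z = v ∘ assoc X Y Z -> u = v.
Proof.
move=> e; have: u ∘ assoc X Y Z ∘ assocV X Y Z = v ∘ assoc X Y Z ∘ assocV X Y Z.
  by rewrite e.
by rewrite !(chain0 _ (assoc_assocV X Y Z)).
Qed.
Lemma assoc_mono X Y Z W (u v : Mor W ((X ⊗ Y) ⊗ Z)) :
  assoc X Y Z ∘ u = assoc X Y Z ∘ v -> u = v.
Proof.
move=> e; have: assocV X Y Z ∘ (assoc X Y Z ∘ u) = assocV X Y Z ∘ (assoc X Y Z ∘ v).
  by rewrite e.
by rewrite !compA assocV_assoc !comp1m.
Qed.

Lemma assocV_nat X X' Y Y' Z Z' (f : Mor X X') (g : Mor Y Y') (h : Mor Z Z') :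
  assocV X' Y' Z' ∘ (f ⊠ (g ⊠ h)) = ((f ⊠ g) ⊠ h) ∘ assocV X Y Z.
Proof.
apply: assoc_mono; rewrite !compA assoc_assocV comp1m assoc_nat.
by rewrite (chain0 _ (assoc_assocV X Y Z)).
Qed.
Lemma assoc_natl X X' Y Z (f : Mor X X') :
  assoc X' Y Z ∘ ((f ▷ Y) ▷ Z) = (f ▷ (Y ⊗ Z)) ∘ assoc X Y Z.
Proof. by rewrite assoc_nat tensm_id. Qed.
Lemma assoc_natr X Y Z Z' (f : Mor Z Z') :
  assoc X Y Z' ∘ ((X ⊗ Y) ◁ f) = (X ◁ (Y ◁ f)) ∘ assoc X Y Z.
Proof. by rewrite -tensm_id assoc_nat. Qed.
Lemma assocV_natl X X' Y Z (f : Mor X X') :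
  assocV X' Y Z ∘ (f ▷ (Y ⊗ Z)) = ((f ▷ Y) ▷ Z) ∘ assocV X Y Z.
Proof. by rewrite -assocV_nat tensm_id. Qed.

Lemma runitV_nat X X' (f : Mor X X') : runitV X' ∘ f = (f ▷ 𝟙) ∘ runitV X.
Proof.
rewrite -[LHS]compm1 -(runit_runitV X) !compA.
by rewrite (chain2 _ (esym (runit_nat f))) runitV_runit comp1m.
Qed.
Lemma whiskr1_inj X Y (f g : Mor X Y) : f ▷ 𝟙 = g ▷ 𝟙 -> f = g.
Proof.
move=> e; rewrite -[f]compm1 -[g]compm1 -(runit_runitV X) !compA.
by rewrite -!runit_nat e.
Qed.
Lemma whiskl1_inj X Y (f g : Mor X Y) : 𝟙 ◁ f = 𝟙 ◁ g -> f = g.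
Proof.
move=> e; rewrite -[f]compm1 -[g]compm1 -(lunit_lunitV X) !compA.
by rewrite -!lunit_nat e.
Qed.

(** Kelly's argument: the pentagon for [X], [Y], [𝟙], [𝟙] and two triangles give the identity
    whiskered by the unit, and whiskering by the unit is faithful. *)
Lemma runit_tens X Y : runit (X ⊗ Y) = (X ◁ runit Y) ∘ assoc X Y 𝟙.
Proof.
apply: whiskr1_inj; apply: (@assoc_mono X Y 𝟙).
rewrite -triangle compA whiskr_comp compA assoc_nat.
rewrite -(triangle Y 𝟙) whiskl_comp.
have := pentagon X Y 𝟙 𝟙 => /(congr1 (fun x => (X ◁ (Y ◁ lunit 𝟙)) ∘ x)).
by rewrite !compA -assoc_natr => <-.
Qed.

Lemma triangleV X Y :
  (runit X ▷ Y) ∘ assocV X 𝟙 Y = X ◁ lunit Y.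
Proof. by rewrite -triangle (chain0 _ (assoc_assocV _ _ _)). Qed.

Lemma assoc_runitV X Y : assoc X 𝟙 Y ∘ (runitV X ▷ Y) = X ◁ lunitV Y.
Proof.
rewrite -[LHS]comp1m -tensm_id -(lunitV_lunit Y) whiskl_comp compA.
rewrite (chain1 _ (triangle X Y)) (chain1 _ (esym (whiskr_comp _ _ _))).
by rewrite runit_runitV tensm_id compm1.
Qed.

Lemma runitV_tens X Y : assoc X Y 𝟙 ∘ runitV (X ⊗ Y) = X ◁ runitV Y.
Proof.
rewrite -[LHS]comp1m -tensm_id -(runitV_runit Y) whiskl_comp compA.
by rewrite (chain1 _ (esym (runit_tens X Y))) (chain0 _ (runit_runitV _)).
Qed.

(* Pairings and copairings act on the functors [A |-> A ⊗ Y], for which iterated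
   application is strictly associative. [locked] keeps rewriting with [compA]
   from unfolding them. *)
Definition kap Y Z (k : Mor (Y ⊗ Z) 𝟙) A : Mor ((A ⊗ Y) ⊗ Z) A :=
  locked (runit A ∘ (A ◁ k) ∘ assoc A Y Z).
Definition cop Y Z (c : Mor 𝟙 (Y ⊗ Z)) A : Mor A ((A ⊗ Y) ⊗ Z) :=
  locked (assocV A Y Z ∘ (A ◁ c) ∘ runitV A).

Lemma kapE Y Z (k : Mor (Y ⊗ Z) 𝟙) A :
  kap k A = runit A ∘ (A ◁ k) ∘ assoc A Y Z.
Proof. by rewrite /kap -lock. Qed.
Lemma copE Y Z (c : Mor 𝟙 (Y ⊗ Z)) A :
  cop c A = assocV A Y Z ∘ (A ◁ c) ∘ runitV A.
Proof. by rewrite /cop -lock. Qed.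

Lemma kap_nat Y Z (k : Mor (Y ⊗ Z) 𝟙) A B (f : Mor A B) :
  kap k B ∘ ((f ▷ Y) ▷ Z) = f ∘ kap k A.
Proof.
rewrite !kapE (chain2 _ (assoc_natl _ _ f)) (chain2 _ (esym (whisk_exchange _ _))).
by rewrite runit_nat !compA.
Qed.
Lemma cop_nat Y Z (c : Mor 𝟙 (Y ⊗ Z)) A B (f : Mor A B) :
  cop c B ∘ f = ((f ▷ Y) ▷ Z) ∘ cop c A.
Proof.
rewrite !copE (chain2 _ (runitV_nat f)) (chain2 _ (esym (whisk_exchange _ _))).
by rewrite assocV_natl !compA.
Qed.

Lemma kap_slidel Y Y' Z (k : Mor (Y' ⊗ Z) 𝟙) (f : Mor Y Y') A :
  kap (k ∘ (f ▷ Z)) A = kap k A ∘ ((A ◁ f) ▷ Z).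
Proof. by rewrite !kapE whiskl_comp !compA (chain2 _ (assoc_nat _ _ _)). Qed.
Lemma kap_slider Y Z Z' (k : Mor (Y ⊗ Z') 𝟙) (f : Mor Z Z') A :
  kap (k ∘ (Y ◁ f)) A = kap k A ∘ ((A ⊗ Y) ◁ f).
Proof. by rewrite !kapE whiskl_comp !compA (chain2 _ (assoc_natr _ _ _)). Qed.

Lemma kap_inj Y Z (k k' : Mor (Y ⊗ Z) 𝟙) : kap k 𝟙 = kap k' 𝟙 -> k = k'.
Proof.
rewrite !kapE => /assoc_epi e; apply: whiskl1_inj.
by rewrite -[LHS]comp1m -[RHS]comp1m -(runitV_runit 𝟙) -!compA e.
Qed.

Lemma kap_tens Y Z (k : Mor (Y ⊗ Z) 𝟙) A B :
  kap k (A ⊗ B) = (A ◁ kap k B) ∘ assoc A (B ⊗ Y) Z ∘ (assoc A B Y ▷ Z).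
Proof.
rewrite !kapE !whiskl_comp (chain32 _ (pentagon A B Y Z)) runit_tens.
by rewrite -(chain2 _ (assoc_natr A B k)).
Qed.

Lemma cop_tens Y Z (c : Mor 𝟙 (Y ⊗ Z)) A B :
  assoc A (B ⊗ Y) Z ∘ (assoc A B Y ▷ Z) ∘ cop c (A ⊗ B) = A ◁ cop c B.
Proof.
rewrite -[LHS]comp1m -tensm_id -(assocV_assoc B Y Z) whiskl_comp !compA.
rewrite (chain32 _ (pentagon A B Y Z)) !copE !compA.
rewrite (chain0 _ (assoc_assocV _ _ _)) (chain2 _ (assoc_natr A B c)).
by rewrite (chain1 _ (runitV_tens A B)) !whiskl_comp.
Qed.

(** With evaluations for [k1] and [k2] this is the pairing whose transpose is [dual_tens]. *)
Definition nest_pairing U P Q V (k1 : Mor (P ⊗ Q) 𝟙) (k2 : Mor (U ⊗ V) 𝟙) :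
    Mor ((U ⊗ P) ⊗ (Q ⊗ V)) 𝟙 :=
  k2 ∘ (U ◁ (lunit V ∘ (k1 ▷ V) ∘ assocV P Q V)) ∘ assoc U P (Q ⊗ V).

(** Two pentagons, one for [A], [U], [P], [Q ⊗ V] and one for [A ⊗ U], [P], [Q], [V], move the
    brackets so that the inner pairing is contracted before the outer one. *)
Lemma kap_nest U P Q V (k1 : Mor (P ⊗ Q) 𝟙) (k2 : Mor (U ⊗ V) 𝟙) A :
  kap (nest_pairing k1 k2) A ∘ assoc (A ⊗ (U ⊗ P)) Q V ∘ (assoc A U P ▷ Q ▷ V) =
  kap k2 A ∘ (kap k1 (A ⊗ U) ▷ V).
Proof.
rewrite (chain2 _ (assoc_natl _ _ _)) !kapE /nest_pairing !whiskl_comp !compA.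
rewrite (chain32 _ (pentagon A U P (Q ⊗ V))).
rewrite -!(chain2 _ (assoc_natr _ _ _)) -(chain32 _ (pentagon (A ⊗ U) P Q V)).
rewrite (chain0 _ (whiskl_inv _ (assocV_assoc _ _ _))).
rewrite -(chain2 _ (assoc_nat _ _ _)) (chain1 _ (triangle _ _)).
by rewrite !whiskr_comp !compA.
Qed.

Lemma nest_pairing_nat U U' P P' Q V (k1 : Mor (P' ⊗ Q) 𝟙)
    (k2 : Mor (U' ⊗ V) 𝟙) (f : Mor U U') (g : Mor P P') :
  nest_pairing (k1 ∘ (g ▷ Q)) (k2 ∘ (f ▷ V)) =
  nest_pairing k1 k2 ∘ ((f ⊠ g) ▷ (Q ⊗ V)).
Proof.
rewrite /nest_pairing whiskr_comp (chain2 _ (assoc_nat _ _ _)).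
rewrite [in RHS](chain1 _ (esym (tensm_comp _ _ _ _))) comp1m.
rewrite (chain2 _ (assocV_natl _ _ _)).
by rewrite (chain1 _ (esym (tensm_split _ _))) !compA.
Qed.

End MonoidalCategory.

(** * Duality, transposition and the partial trace of a pivotal structure *)

Section RigidCategory.
Context {K : fieldType} {C : rigidcat K}.
Implicit Types X Y Z W A B : C.
Local Notation "𝟙" := (unitob C).
Local Notation cup Y A := (cop (coev Y) A).
Local Notation cap Y A := (kap (ev Y) A).

(** The pentagon, in the form of [kap_tens], pulls the strand [A] out to the left, and the bare
    zigzag identity remains. *)
Lemma kap_cop X X' (e : Mor (X' ⊗ X) 𝟙) (c : Mor 𝟙 (X ⊗ X')) A :
  runit X ∘ (X ◁ e) ∘ assoc X X' X ∘ (c ▷ X) ∘ lunitV X = idmor X ->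
  kap e (A ⊗ X) ∘ (cop c A ▷ X) = idmor (A ⊗ X).
Proof.
move=> ec; rewrite kap_tens copE !whiskr_comp !compA.
rewrite (chain0 _ (whiskr_inv _ (assoc_assocV _ _ _))).
rewrite (chain2 _ (assoc_nat _ _ _)) (chain1 _ (assoc_runitV _ _)) -!whiskl_comp.
by rewrite kapE ec tensm_id.
Qed.

Lemma zigzag X A : cap X (A ⊗ X) ∘ (cup X A ▷ X) = idmor (A ⊗ X).
Proof. by apply: kap_cop; case: (dualP X). Qed.

Lemma transpose_cup Z X (e : Mor (Z ⊗ X) 𝟙) :
  transpose e = lunit (dual X) ∘ (e ▷ dual X) ∘ cup X Z.
Proof. by rewrite /transpose copE !compA. Qed.

Lemma whisk_transpose Z X (e : Mor (Z ⊗ X) 𝟙) B :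
  B ◁ transpose e = (kap e B ▷ dual X) ∘ cup X (B ⊗ Z).
Proof.
rewrite transpose_cup !whiskl_comp -cop_tens -triangleV !compA.
rewrite (chain2 _ (assocV_nat _ _ _)) (chain0 _ (assocV_assoc _ _ _)).
by rewrite kapE !whiskr_comp.
Qed.

Lemma transposeK Z X (e : Mor (Z ⊗ X) 𝟙) : ev X ∘ (transpose e ▷ X) = e.
Proof.
apply: kap_inj; rewrite kap_slidel whisk_transpose whiskr_comp compA kap_nat.
by rewrite (chain0 _ (zigzag _ _)).
Qed.

Lemma zigzag_dual X B : (cap X B ▷ dual X) ∘ cup X (B ⊗ dual X) = idmor _.
Proof.
rewrite -whisk_transpose; have [_] := dualP X; rewrite -/(transpose (ev X)) => ->.
exact: tensm_id.
Qed.

(** Half of the adjunction between tensoring with [X] and with [dual X], from the second zigzag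
    identity. *)
Lemma cap_epi W X B (g g' : Mor W (B ⊗ dual X)) :
  cap X B ∘ (g ▷ X) = cap X B ∘ (g' ▷ X) -> g = g'.
Proof.
move=> e; rewrite -[g]comp1m -[g']comp1m -(zigzag_dual X B) -!compA !cop_nat !compA.
by rewrite -!whiskr_comp e.
Qed.

Lemma dualm_ev X Y (f : Mor X Y) : ev X ∘ (dualm f ▷ X) = ev Y ∘ (dual Y ◁ f).
Proof. exact: transposeK. Qed.

(* A copairing that satisfies one zigzag identity with [e] is the coevaluation,
   transported along the comparison map [transpose e]. *)
Lemma cup_transpose X X' (e : Mor (X' ⊗ X) 𝟙) A (u : Mor A ((A ⊗ X) ⊗ X')) :
  kap e (A ⊗ X) ∘ (u ▷ X) = idmor _ ->
  cup X A = ((A ⊗ X) ◁ transpose e) ∘ u.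
Proof.
move=> zz; rewrite whisk_transpose -compA cop_nat compA -whiskr_comp zz.
by rewrite tensm_id comp1m.
Qed.

Lemma cup_dualm X Y (f : Mor X Y) A :
  ((A ◁ f) ▷ dual X) ∘ cup X A = ((A ⊗ Y) ◁ dualm f) ∘ cup Y A.
Proof.
rewrite whisk_transpose -compA cop_nat compA -whiskr_comp kap_slider.
by rewrite -compA -whisk_exchange compA zigzag comp1m.
Qed.

Variable p : pivotal_structure C.

(** The evaluation on the other side of [Y], supplied by the pivotal structure. *)
Definition cocap Y : Mor (Y ⊗ dual Y) 𝟙 := ev (dual Y) ∘ (piv p Y ▷ dual Y).

Lemma cocap_dualm X Y (f : Mor X Y) :
  cocap Y ∘ (f ▷ dual Y) = cocap X ∘ (X ◁ dualm f).
Proof.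
rewrite /cocap -!compA -whiskr_comp piv_nat whiskr_comp !compA dualm_ev.
by rewrite (chain2 _ (whisk_exchange _ _)).
Qed.

(** The partial trace: the strand [Y] is closed up on the right. *)
Definition ptr Y A B (f : Mor (A ⊗ Y) (B ⊗ Y)) : Mor A B :=
  locked (kap (cocap Y) B ∘ (f ▷ dual Y) ∘ cup Y A).

Lemma ptrE Y A B (f : Mor (A ⊗ Y) (B ⊗ Y)) :
  ptr f = kap (cocap Y) B ∘ (f ▷ dual Y) ∘ cup Y A.
Proof. by rewrite /ptr -lock. Qed.

Lemma ptr_linear Y A B : linear (@ptr Y A B).
Proof.
move=> a f g; rewrite !ptrE tensDl tensZl compDr compZr compDl compZl.
by [].
Qed.

Lemma ptr0 Y A B : ptr (0 : Mor (A ⊗ Y) (B ⊗ Y)) = 0.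
Proof. exact: linearE0 (@ptr_linear Y A B). Qed.
Lemma ptrD Y A B (f g : Mor (A ⊗ Y) (B ⊗ Y)) : ptr (f + g) = ptr f + ptr g.
Proof. exact: linearED (@ptr_linear Y A B) _ _. Qed.
Lemma ptrZ Y A B a (f : Mor (A ⊗ Y) (B ⊗ Y)) : ptr (a *: f) = a *: ptr f.
Proof. exact: linearEZ (@ptr_linear Y A B) _ _. Qed.
Lemma ptr_sum Y A B (I : Type) (r : seq I) (P : pred I)
    (F : I -> Mor (A ⊗ Y) (B ⊗ Y)) :
  ptr (\sum_(i <- r | P i) F i) = \sum_(i <- r | P i) ptr (F i).
Proof. exact: linearE_sum (@ptr_linear Y A B) _ _ _ _. Qed.

Lemma ptr_nat Y A A' B B' (f : Mor (A ⊗ Y) (B ⊗ Y)) (a : Mor A' A) (b : Mor B B') :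
  ptr ((b ▷ Y) ∘ f ∘ (a ▷ Y)) = b ∘ ptr f ∘ a.
Proof. by rewrite !ptrE !whiskr_comp !compA kap_nat -[RHS]compA cop_nat !compA. Qed.

Lemma ptr_natl Y A B B' (f : Mor (A ⊗ Y) (B ⊗ Y)) (b : Mor B B') :
  ptr ((b ▷ Y) ∘ f) = b ∘ ptr f.
Proof. by have := ptr_nat f (idmor A) b; rewrite tensm_id !compm1. Qed.

Lemma ptr_natr Y A A' B (f : Mor (A ⊗ Y) (B ⊗ Y)) (a : Mor A' A) :
  ptr (f ∘ (a ▷ Y)) = ptr f ∘ a.
Proof. by have := ptr_nat f a (idmor B); rewrite tensm_id !comp1m. Qed.

(** [f] travels round the closed strand: the cup turns it into [dualm f], and the cap turns it back
    by naturality of [piv]. *)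
Lemma ptr_cyclic Y Y' A B (f : Mor Y Y') (g : Mor (A ⊗ Y') (B ⊗ Y)) :
  ptr (g ∘ (A ◁ f)) = ptr ((B ◁ f) ∘ g).
Proof.
rewrite !ptrE !whiskr_comp !compA -kap_slidel cocap_dualm kap_slider.
by rewrite (chain1 _ (cup_dualm _ _)) !compA (chain2 _ (whisk_exchange _ _)).
Qed.

Lemma ptr_tens A B B' Y (f : Mor (B ⊗ Y) (B' ⊗ Y)) :
  ptr (assocV A B' Y ∘ (A ◁ f) ∘ assoc A B Y) = A ◁ ptr f.
Proof.
rewrite !ptrE !whiskr_comp kap_tens !whiskl_comp -cop_tens !compA.
rewrite (chain0 _ (whiskr_inv _ (assoc_assocV _ _ _))).
by rewrite (chain2 _ (assoc_nat _ _ _)).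
Qed.

Lemma ptr_whisk A Y (f : Mor Y Y) :
  ptr (A ◁ f) = runit A ∘ (A ◁ right_trace p f) ∘ runitV A.
Proof.
rewrite !ptrE kapE copE /right_trace !compA (chain2 _ (assoc_nat _ _ _)).
rewrite (chain0 _ (assoc_assocV _ _ _)) /cocap -!compA; congr (_ ∘ _).
by rewrite !compA -!whiskl_comp whiskr_comp !compA.
Qed.

(** Lets a partial trace be computed with another dual [X'] of [X]; the comparison map [transpose e]
    is moved from the copairing to the cap. *)
Lemma ptr_transpose X X' (e : Mor (X' ⊗ X) 𝟙) A B (u : Mor A ((A ⊗ X) ⊗ X'))
    (f : Mor (A ⊗ X) (B ⊗ X)) :
  kap e (A ⊗ X) ∘ (u ▷ X) = idmor _ ->
  ptr f = kap (cocap X ∘ (X ◁ transpose e)) B ∘ (f ▷ X') ∘ u.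
Proof.
move=> /cup_transpose eu; rewrite ptrE eu kap_slider !compA.
by rewrite (chain2 _ (whisk_exchange _ _)).
Qed.

(** The unit is used as its own dual through [lunit 𝟙]; by [piv_one] the resulting cap is again
    [lunit 𝟙]. *)
Lemma ptr_one A B (f : Mor (A ⊗ 𝟙) (B ⊗ 𝟙)) : ptr f = runit B ∘ f ∘ runitV A.
Proof.
have kapl D : kap (lunit 𝟙) D = runit D ∘ runit (D ⊗ 𝟙).
  rewrite kapE (chain1 _ (triangle _ _)).
  by rewrite runit_nat.
have zz : kap (lunit 𝟙) (A ⊗ 𝟙) ∘ ((runitV (A ⊗ 𝟙) ∘ runitV A) ▷ 𝟙) = idmor _.
  by rewrite kapl -compA runit_nat !compA runit_runitV comp1m runitV_runit.
rewrite (ptr_transpose _ zz) -/(dual_one C).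
have -> : cocap 𝟙 ∘ (𝟙 ◁ dual_one C) = lunit 𝟙.
  rewrite /cocap (chain2 _ (whisk_exchange _ _)) -dualm_ev -compA -whiskr_comp.
  by rewrite piv_one transposeK.
rewrite kapl !compA (chain2 _ (runit_nat f)) (chain1 _ (runit_runitV _)).
by rewrite compm1.
Qed.

(** [dual Z ⊗ dual Y] is used as the dual of [Y ⊗ Z]: nested cups satisfy the zigzag identity with
    the nested evaluation, and by [piv_tens] the resulting cap is the nesting of the two
    [cocap]s. *)
Lemma ptr_tensor Y Z A B (f : Mor (A ⊗ (Y ⊗ Z)) (B ⊗ (Y ⊗ Z))) :
  ptr f = ptr (ptr (assocV B Y Z ∘ f ∘ assoc A Y Z)).
Proof.
pose e := nest_pairing (ev Y) (ev Z).
have dt : dual_tens Y Z = transpose e by rewrite /dual_tens /e /nest_pairing.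
pose a A := assoc (A ⊗ (Y ⊗ Z)) (dual Z) (dual Y) ∘ (assoc A Y Z ▷ dual Z ▷ dual Y).
pose u := a A ∘ (cup Z (A ⊗ Y) ▷ dual Y) ∘ cup Y A.
have zz : kap e (A ⊗ (Y ⊗ Z)) ∘ (u ▷ (Y ⊗ Z)) = idmor _.
  apply: assoc_epi; rewrite -(chain2 _ (assoc_natl _ _ _)) comp1m.
  rewrite /u /a !whiskr_comp !compA kap_nest.
  have capY D E (g : Mor D E) :
      (cap Y E ▷ Z) ∘ (g ▷ dual Y ▷ Y ▷ Z) = (g ▷ Z) ∘ (cap Y D ▷ Z).
    by rewrite -!whiskr_comp kap_nat.
  rewrite !(chain2 _ (capY _ _ _)) kap_nat (chain0 _ (zigzag _ _)).
  by rewrite (chain0 _ (whiskr_inv _ (zigzag _ _))).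
rewrite (ptr_transpose _ zz) -dt.
have -> : cocap (Y ⊗ Z) ∘ ((Y ⊗ Z) ◁ dual_tens Y Z) =
    nest_pairing (cocap Z) (cocap Y).
  rewrite /cocap (nest_pairing_nat (ev (dual Z)) (ev (dual Y))).
  rewrite (chain2 _ (whisk_exchange _ _)) -dualm_ev -compA -whiskr_comp piv_tens.
  by rewrite whiskr_comp compA transposeK.
have kapn D : kap (nest_pairing (cocap Z) (cocap Y)) D ∘ a D =
    kap (cocap Y) D ∘ (kap (cocap Z) (D ⊗ Y) ▷ dual Y).
  by rewrite -kap_nest /a !compA.
rewrite !ptrE !whiskr_comp !compA -kapn /u /a !compA.
rewrite (chain0 _ (whiskr_inv _ (whiskr_inv _ (assoc_assocV _ _ _)))).
by rewrite !(chain2 _ (assoc_natl _ _ _)).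
Qed.

(* Sliding the evaluation around the trace of [coev (dual X) ∘ ev X] turns the
   left trace of [X] into the right trace of [dual X]. *)
Lemma ptr_cup_cap X :
  ptr ((dual X ◁ pivV p X) ∘ coev (dual X) ∘ ev X) = idmor (dual X).
Proof.
have evV : (ev X ▷ dual X) ∘ cup X (dual X) = lunitV (dual X).
  rewrite -[LHS]comp1m -(lunitV_lunit (dual X)) -!compA.
  rewrite [lunit _ ∘ _]compA -transpose_cup.
  by case: (dualP X) => _; rewrite -/(transpose (ev X)) => ->; rewrite compm1.
have capV : cocap X ∘ (pivV p X ▷ dual X) = ev (dual X).
  rewrite /cocap -compA -whiskr_comp; case: (pivK p X) => _ ->.
  by rewrite tensm_id compm1.
rewrite !ptrE !whiskr_comp !compA (chain1 _ evV) -kap_slidel capV kapE.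
by case: (dualP (dual X)).
Qed.

End RigidCategory.

(** * Eigenvectors, Schur's lemma, splitting of idempotents, finite direct sums, duals of invertible
    objects *)

Import VectorInternalTheory.

Lemma linear_eigenvector (K : closedFieldType) (V : vectType K)
    (f : {linear V -> V}) (u : V) :
  u != 0 -> exists a v, v != 0 /\ f v = a *: v.
Proof.
move=> u0; pose A := lin1_mx (v2r \o f \o r2v).
have [a]: exists a, root (char_poly A) a.
  (* The characteristic polynomial is constant only in dimension 0, where [u] would vanish. *)
  apply/closed_rootP; rewrite size_char_poly eqSS; apply: contra u0 => /eqP d0.
  rewrite -(can_eq v2rK) linear0; apply/eqP/rowP => j.
  by have := ltn_ord j; rewrite [X in (_ < X)%N]d0.
rewrite -eigenvalue_root_char => /eigenvalueP[v vA v0].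
exists a, (r2v v); split; first by rewrite -(can_eq v2rK) r2vK linear0.
by apply: (can_inj v2rK); rewrite linearZ /= r2vK -vA mul_rV_lin1.
Qed.

Section Schur.
Context {K : closedFieldType} {C : lincat K}.
Hypothesis abC : is_abelian C.
Implicit Types X Y Z : C.

Lemma kernel_monic X Y N (f : Mor X Y) (k : Mor N X) : is_kernel f k -> monic k.
Proof.
move=> [fk ker_k] Z u v kuv.
have [|w [_ uniq_w]] := ker_k Z (k ∘ u); first by rewrite compA fk comp0m.
by rewrite -(uniq_w u erefl) (uniq_w v (esym kuv)).
Qed.

Lemma simple_id_neq0 X : simple_object X -> idmor X != 0.
Proof.
move=> [nzX _]; apply/eqP => id0; apply: nzX => Y.
by split=> f; [rewrite -[f]compm1 id0 compm0 | rewrite -[f]comp1m id0 comp0m].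
Qed.

(** Schur's lemma. The kernel of [f] is monic into the simple object [X]: if it is an isomorphism
    then [f = 0], and if its source is zero then [f] is monic into the simple object [Y]. *)
Lemma simple_map X Y (f : Mor X Y) :
  simple_object X -> simple_object Y -> f = 0 \/ is_iso f.
Proof.
case: abC => _ _ kerC _ _ [nzX sX] [nzY sY].
have [[N [k ker_k]] _] := kerC _ _ f.
case: (sX N k (kernel_monic ker_k)) => [N0|[k' [_ kk']]]; last first.
  by left; rewrite -[f]compm1 -kk' compA; case: ker_k => -> _; rewrite comp0m.
right; case: (sY X f) => // Z u v fuv; apply/eqP; rewrite -subr_eq0; apply/eqP.
have [|w [<- _]] := ker_k.2 Z (u - v); first by rewrite compBr fuv subrr.
by rewrite ((N0 Z).2 w) compm0.
Qed.

Lemma simple_hom0 X Y (f : Mor X Y) :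
  simple_object X -> simple_object Y -> ~ X ≅ Y -> f = 0.
Proof. by move=> sX sY nXY; case: (simple_map f sX sY) => // ?; case: nXY; exists f.
Qed.

(** An eigenvector [v] of composition with [f] is killed by [f - a *: idmor X], which is then not an
    isomorphism and vanishes by Schur's lemma. *)
Lemma simple_end X (f : Mor X X) :
  simple_object X -> exists a, f = a *: idmor X.
Proof.
move=> sX; pose cf_lin := GRing.isLinear.Build K (Mor X X) (Mor X X) _ _
  (comp_linear_r f).
pose cf : {linear Mor X X -> Mor X X} :=
  HB.pack (fun g : Mor X X => f ∘ g) cf_lin.
have [a [v [v0 fv]]] := linear_eigenvector cf (simple_id_neq0 sX).
exists a; apply/eqP; rewrite -subr_eq0; apply/eqP.
case: (simple_map (f - a *: idmor X) sX sX) => // -[h [hf _]].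
case/eqP: v0; rewrite -[v]comp1m -hf -compA compBl compZl comp1m.
by rewrite [f ∘ v]fv subrr compm0.
Qed.

(** The kernel of [idmor X - e] serves as the image of [e]. *)
Lemma idempotent_split X (e : Mor X X) : e ∘ e = e ->
  exists N (k : Mor N X) (v : Mor X N), v ∘ k = idmor N /\ k ∘ v = e.
Proof.
case: abC => _ _ kerC _ _ ee.
have [[N [k ker_k]] _] := kerC _ _ (idmor X - e).
have [|v [kv _]] := ker_k.2 X e; first by rewrite compBl comp1m ee subrr.
have /eqP := ker_k.1; rewrite compBl comp1m subr_eq0 => /eqP ek.
exists N, k, v; split=> //; apply: (kernel_monic ker_k).
by rewrite compA kv compm1 -ek.
Qed.

(** A Kronecker delta with values in morphisms. The transport is there because [X i] and [X j] are
    different types of endpoints even when [i = j] is provable. *)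
Definition castmor (I : eqType) (X : I -> C) i j : Mor (X i) (X j) :=
  if i =P j is ReflectT e then ecast j (Mor (X i) (X j)) e (idmor (X i)) else 0.

Lemma castmor_id (I : eqType) (X : I -> C) i : castmor X i i = idmor (X i).
Proof. by rewrite /castmor; case: eqP => // e; rewrite eq_axiomK. Qed.

Lemma castmor_neq (I : eqType) (X : I -> C) i j : i != j -> castmor X i j = 0.
Proof. by rewrite /castmor; case: eqP. Qed.

(** Induction on the enumeration of [I], with one binary sum per index. The structure maps of the
    indices not yet reached are 0, so that both families are defined on all of [I] throughout. *)
Lemma direct_sum_exists (I : finType) (X : I -> C) : exists S, is_direct_sum X S.
Proof.
have: exists S (inj : forall i, Mor (X i) S) (proj : forall i, Mor S (X i)),
    [/\ forall i, i \in enum I -> proj i ∘ inj i = idmor (X i),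
        forall i j, i != j -> proj j ∘ inj i = 0,
        forall i, i \notin enum I -> inj i = 0 /\ proj i = 0
      & \sum_(i <- enum I) inj i ∘ proj i = idmor S].
  elim: (enum I) (enum_uniq I) => [_|i0 s IHs /= /andP[i0s /IHs]].
    case: abC => -[Z Z0] _ _ _ _; exists Z, (fun _ => 0), (fun _ => 0).
    by split=> // *; rewrite ?comp0m ?big_nil //; apply/esym; exact: (Z0 Z).1.
  move=> [S [inj [proj [pi_id pi0 off si]]]].
  case: abC => _ /(_ (X i0) S)[T [a [b [ba ba0 abT]]]] _ _ _.
  have ba1 := ba true; have ba2 := ba false.
  have ba12 := ba0 true false isT; have ba21 := ba0 false true isT.
  rewrite big_bool /= in abT.
  have [inj0 proj0] := off i0 i0s.
  exists T, (fun i => a true ∘ castmor X i i0 + a false ∘ inj i),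
     (fun i => castmor X i0 i ∘ b true + proj i ∘ b false).
  have prodE i j : (castmor X i0 j ∘ b true + proj j ∘ b false) ∘
      (a true ∘ castmor X i i0 + a false ∘ inj i) =
      castmor X i0 j ∘ castmor X i i0 + proj j ∘ inj i.
    rewrite compDl !compDr !compA (chain0 _ ba1) (chain0 _ ba2).
    by rewrite (chain1 _ ba12) (chain1 _ ba21) !compm0 !comp0m add0r addr0.
  split.
  - move=> i; rewrite inE prodE => /orP[/eqP->|si_i].
      by rewrite castmor_id comp1m inj0 compm0 addr0.
    have /castmor_neq-> : i != i0 by apply: contraNneq i0s => <-.
    by rewrite compm0 add0r pi_id.
  - move=> i j ij; rewrite prodE pi0 // addr0.
    case: (eqVneq i i0) ij => [->|ii0] ij; first by rewrite castmor_neq ?comp0m.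
    by rewrite [castmor X i i0]castmor_neq ?compm0.
  - move=> i; rewrite inE negb_or => /andP[ii0 /off[-> ->]].
    have i0i : i0 != i by rewrite eq_sym.
    by rewrite !castmor_neq // !comp0m !compm0 !addr0.
  rewrite big_cons !castmor_id inj0 proj0 compm0 comp0m !addr0 compm1 comp1m.
  rewrite -[RHS]abT; congr (_ + _).
  rewrite -[X in _ = X ∘ _]compm1 -si comp_sumr comp_suml.
  apply: eq_big_seq => i si_i.
  have ii0: i != i0 by apply: contraNneq i0s => <-.
  have i0i: i0 != i by rewrite eq_sym.
  by rewrite !castmor_neq // !comp0m !compm0 !add0r !compA.
move=> [S [inj [proj [pi_id pi0 _ si]]]]; exists S, inj, proj; split=> //.
  by move=> i; rewrite pi_id ?mem_enum.
by rewrite -si big_enum.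
Qed.

End Schur.

(** For arbitrary isomorphisms the zigzag composite is an endomorphism of the simple object [X],
    hence a nonzero scalar; rescaling the copairing makes one zigzag identity hold, and then
    [transpose e] is invertible. *)
Lemma dual_of_inverse (K : closedFieldType) (C : rigidcat K) (X Y : C) :
  is_abelian C -> simple_object X ->
  X ⊗ Y ≅ unitob C -> Y ⊗ X ≅ unitob C -> Y ≅ dual X.
Proof.
move=> abC sX [f [f' [f'f ff']]] [e [e' [e'e ee']]].
pose zz c := runit X ∘ (X ◁ e) ∘ assoc X Y X ∘ (c ▷ X) ∘ lunitV X.
have [c [c' [c'c cc'] zc]] : exists2 c : Mor (unitob C) (X ⊗ Y),
    exists c', inverse_pair c c' & zz c = idmor X.
  have [a a_zz] := simple_end abC (zz f') sX.
  have a0 : a != 0.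
    apply: contraNneq (simple_id_neq0 sX) => a0; move: a_zz.
    rewrite a0 scale0r => zz0.
    (* The right inverse is composed of the inverses of the factors of [zz f'], so [zz f' = 0] would
       make [idmor X] zero. *)
    have <- : zz f' ∘ (lunit X ∘ (f ▷ X) ∘ assocV X Y X ∘ (X ◁ e') ∘ runitV X) =
        idmor X.
      rewrite /zz !compA (chain0 _ (lunitV_lunit X)).
      rewrite (chain0 _ (whiskr_inv _ f'f)).
      rewrite (chain0 _ (assoc_assocV _ _ _)).
      rewrite (chain0 _ (whiskl_inv _ ee')).
      exact: runit_runitV.
    by rewrite zz0 comp0m.
  exists (a^-1 *: f'); first exists (a *: f).
    by split; rewrite compZl compZr scalerA ?mulVf ?mulfV // scale1r.
  by rewrite /zz tensZl compZr compZl -/(zz f') a_zz scalerA mulVf // scale1r.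
pose t := transpose e; exists t.
have cupt A : cop (coev X) A = ((A ⊗ X) ◁ t) ∘ cop c A.
  exact: cup_transpose (kap_cop A zc).
have capc A : kap c' A ∘ cop c A = idmor A.
  rewrite kapE copE !compA (chain0 _ (assoc_assocV _ _ _)).
  rewrite (chain0 _ (whiskl_inv _ c'c)).
  exact: runit_runitV.
pose s := kap c' Y ∘ ((e' ∘ ev X) ▷ Y) ∘ cop c (dual X); exists s.
have st : s ∘ t = idmor Y.
  rewrite /s -compA cop_nat compA (chain1 _ (esym (whiskr_comp _ _ _))).
  by rewrite -[e' ∘ ev X ∘ _]compA transposeK e'e tensm_id compm1 capc.
(* The defect [n] of the other identity vanishes after [t]. Every cup of [X] factors through [t], so
   [n] kills all cups, and the zigzag identity for [dual X] gives [n = 0]. *)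
split=> //; apply/eqP; rewrite eq_sym -subr_eq0; apply/eqP.
set n := _ - _.
have nt : n ∘ t = 0 by rewrite compBl comp1m -compA st compm1 subrr.
have ncup A : ((A ⊗ X) ◁ n) ∘ cop (coev X) A = 0.
  by rewrite cupt compA -whiskl_comp nt tensm0 comp0m.
apply: whiskl1_inj; rewrite tensm0 -[LHS]compm1 -zigzag_dual compA.
by rewrite -whisk_exchange -compA ncup compm0.
Qed.

(** * The idempotent obtained by averaging over a cyclic group and an involution modulo [N] *)

Section AveragingIdempotent.
Context {K : fieldType} {C : lincat K} {X : C}.
Variables (U : nat -> Mor X X) (V N : Mor X X) (k : nat) (ω m : K).
Hypotheses (U0 : U 0%N = idmor X) (UD : forall i j, U (i + j)%N = U i ∘ U j)
  (Uk : U k = idmor X) (UV : forall i, U i ∘ V = V ∘ U i)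
  (UN : forall i, U i ∘ N = N) (VV : V ∘ V = idmor X + m *: (N ∘ V)).
Hypotheses (ωk : ω ^+ k = 1) (ω_sum : \sum_(i < k) ω ^+ i = 0).

(** For [k] invertible in [K], this is [k] times the projector onto the part where [U 1] acts as the
    inverse of [ω]. *)
Definition average := \sum_(i < k) ω ^+ i *: U i.

Lemma average_shift j : ω ^+ j *: (U j ∘ average) = average.
Proof.
elim: j => [|j IHj]; first by rewrite U0 comp1m scale1r.
rewrite -[RHS]IHj -addn1 UD exprD expr1 -scalerA -compA -compZr.
congr (_ *: (_ ∘ _)).
(* Adding [U 0] completes both sides to the sum of [k.+1] terms, since term [k] equals term 0. *)
rewrite comp_sumr scaler_sumr; apply: (addrI (U 0%N)).
have -> : U 0%N + average = \sum_(i < k.+1) ω ^+ i *: U i.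
  by rewrite big_ord_recr /= ωk scale1r Uk U0 addrC.
rewrite big_ord_recl /= scale1r; congr (_ + _); apply: eq_bigr => i _.
by rewrite compZr scalerA -exprS -UD.
Qed.

Lemma average_sqr : average ∘ average = k%:R *: average.
Proof.
rewrite {1}/average comp_suml (eq_bigr (fun=> average)) => [|i _]; last first.
  by rewrite compZl average_shift.
by rewrite sumr_const card_ord scaler_nat.
Qed.

(** Since the powers of [ω] sum to 0, [average] kills [N]. Up to [N] the square of [V] is the
    identity, so [idmor X + V] squares to twice itself, while [average] squares to [k] times itself
    and commutes with [V]. *)
Lemma averaging_idempotent (q := (2 * k%:R)^-1 *: (average ∘ (idmor X + V))) :
  2 * k%:R != 0 :> K -> q ∘ q = q.
Proof.
move=> k0; rewrite /q compZl compZr scalerA.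
have EV : average ∘ V = V ∘ average.
  rewrite /average comp_suml comp_sumr; apply: eq_bigr => i _.
  by rewrite compZl compZr UV.
have EN : average ∘ N = 0.
  rewrite /average comp_suml (eq_bigr (fun i : 'I_k => ω ^+ i *: N)) => [|i _].
    by rewrite -scaler_suml ω_sum scale0r.
  by rewrite compZl UN.
have E1V : (idmor X + V) ∘ average = average ∘ (idmor X + V).
  by rewrite compDl compDr comp1m compm1 EV.
have -> : average ∘ (idmor X + V) ∘ (average ∘ (idmor X + V)) =
    (2 * k%:R) *: (average ∘ (idmor X + V)).
  rewrite compA (chain2 _ E1V) average_sqr compZl compZl -!compA mulrC -scalerA.
  congr (_ *: _).
  have -> : (idmor X + V) ∘ (idmor X + V) = 2 *: (idmor X + V) + m *: (N ∘ V).
    rewrite compDl comp1m compDr compm1 VV scaler_nat mulr2n !addrA.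
    by rewrite -(addrA _ V (idmor X)) [V + idmor X]addrC addrA.
  by rewrite [LHS]compDr !compZr compA EN comp0m scaler0 addr0.
by rewrite scalerA -mulrA mulVf // mulr1.
Qed.

End AveragingIdempotent.

(** * Scalar traces and dimensions *)

Section Trace.
Context {K : closedFieldType} {C : rigidcat K}.
Local Notation "𝟙" := (unitob C).
Hypotheses (abC : is_abelian C) (simple1 : simple_object 𝟙).
Variable p : pivotal_structure C.
Implicit Types X Y Z A B : C.

Lemma unit_scale_inj a b : a *: idmor 𝟙 = b *: idmor 𝟙 -> a = b.
Proof.
move/eqP; rewrite -subr_eq0 -scalerBl scaler_eq0 subr_eq0.
by rewrite (negPf (simple_id_neq0 simple1)) orbF => /eqP.
Qed.

Definition tr X (f : Mor X X) : K :=
  sval (cid (simple_end abC (right_trace p f) simple1)).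

Lemma trE X (f : Mor X X) : right_trace p f = tr f *: idmor 𝟙.
Proof. by rewrite /tr; case: cid. Qed.

Lemma ptr_scalar A X (f : Mor X X) : ptr p (A ◁ f) = tr f *: idmor A.
Proof.
by rewrite ptr_whisk trE tensZr tensm_id compZr compm1 compZl runit_runitV.
Qed.

Lemma tr_ptr1 X (f : Mor X X) a : ptr p (𝟙 ◁ f) = a *: idmor 𝟙 -> tr f = a.
Proof. by rewrite ptr_scalar => /unit_scale_inj. Qed.

Lemma trD X (f g : Mor X X) : tr (f + g) = tr f + tr g.
Proof.
apply: tr_ptr1; rewrite (linearED (tensm_linear_r _)) ptrD.
by rewrite !ptr_scalar scalerDl.
Qed.

Lemma trZ X a (f : Mor X X) : tr (a *: f) = a * tr f.
Proof.
by apply: tr_ptr1; rewrite tensZr ptrZ ptr_scalar scalerA.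
Qed.

Lemma tr0 X : tr (0 : Mor X X) = 0.
Proof. by rewrite -(scale0r 0) trZ mul0r. Qed.

Lemma tr_sum X (I : Type) (r : seq I) (P : pred I) (F : I -> Mor X X) :
  tr (\sum_(i <- r | P i) F i) = \sum_(i <- r | P i) tr (F i).
Proof. exact: (big_morph _ (@trD X) (tr0 X)). Qed.

Lemma trC X Y (f : Mor X Y) (g : Mor Y X) : tr (g ∘ f) = tr (f ∘ g).
Proof.
by apply: tr_ptr1; rewrite whiskl_comp ptr_cyclic -whiskl_comp ptr_scalar.
Qed.

Lemma tr_ptr X Y (f : Mor (X ⊗ Y) (X ⊗ Y)) : tr f = tr (ptr p f).
Proof. by apply: tr_ptr1; rewrite ptr_tensor ptr_tens ptr_scalar. Qed.

Lemma tr_unit (f : Mor 𝟙 𝟙) : f = tr f *: idmor 𝟙.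
Proof.
have [a ->] := simple_end abC f simple1; congr (_ *: _); apply/esym/tr_ptr1.
rewrite tensZr ptrZ tensm_id ptr_one compm1.
by rewrite runit_runitV.
Qed.

Definition dim X : K := tr (idmor X).

Lemma dim_unit : dim 𝟙 = 1.
Proof. by apply: unit_scale_inj; rewrite -tr_unit scale1r. Qed.

Lemma dim_tens X Y : dim (X ⊗ Y) = dim X * dim Y.
Proof. by rewrite /dim tr_ptr -tensm_id ptr_scalar trZ mulrC. Qed.

Lemma dim_iso X Y : X ≅ Y -> dim X = dim Y.
Proof. by case=> f [g [gf fg]]; rewrite /dim -gf -fg trC. Qed.

Lemma dim_sum (I : finType) (X : I -> C) S (inj : forall i, Mor (X i) S)
    (proj : forall i, Mor S (X i)) :
  (forall i, proj i ∘ inj i = idmor (X i)) ->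
  \sum_i inj i ∘ proj i = idmor S -> dim S = \sum_i dim (X i).
Proof.
move=> pi_id si; rewrite /dim -si tr_sum; apply: eq_bigr => i _.
by rewrite trC pi_id.
Qed.

(** By [ptr_cup_cap] and cyclicity, the dimension of [dual X] is the left trace of [idmor X], which
    sphericality equates with the right trace. *)
Lemma dim_dual X : is_spherical p -> dim (dual X) = dim X.
Proof.
move=> sph; apply: unit_scale_inj.
rewrite -[RHS]trE -sph /dim -(ptr_cup_cap p X) -tr_ptr.
by rewrite trC -tr_unit /left_trace comp1m compA.
Qed.

End Trace.

Arguments tr {K C} abC simple1 p {X} f.
Arguments dim {K C} abC simple1 p X.

(** * Natural families of maps [W ⊗ B -> B] and the action on them by partial traces *)

Section AdjointObject.
Context {K : closedFieldType} {C : rigidcat K}.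
Local Notation "𝟙" := (unitob C).
Local Notation cup Y A := (cop (coev Y) A).
Local Notation cap Y A := (kap (ev Y) A).
Hypotheses (abC : is_abelian C) (simple1 : simple_object 𝟙).
Hypothesis ssC : is_semisimple C.
Variable p : pivotal_structure C.
Local Notation ptr := (ptr p).
Local Notation tr := (tr abC simple1 p).
Local Notation dim := (dim abC simple1 p).

Variables (I : finType) (S : I -> C).
Hypotheses (S_simple : forall i, simple_object (S i))
  (S_inj : forall i j, S i ≅ S j -> i = j)
  (S_all : forall X : C, simple_object X -> exists i, X ≅ S i).
Implicit Types X Y Z W A B : C.

Lemma decomposition B : exists n (c : 'I_n -> I)
    (inj : forall a, Mor (S (c a)) B) (proj : forall a, Mor B (S (c a))),
  (forall a, proj a ∘ inj a = idmor (S (c a))) /\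
  \sum_a inj a ∘ proj a = idmor B.
Proof.
have [n [F [F_simple [inj [proj [pi_id _ si]]]]]] := ssC B.
have /fin_all_exists[c Fc] : forall a, exists i, F a ≅ S i by move=> a; exact: S_all.
have /fin_all_exists[f /fin_all_exists[g fg]] := Fc.
exists n, c, (fun a => inj a ∘ g a), (fun a => f a ∘ proj a); split.
  by move=> a; rewrite !compA (chain0 _ (pi_id a)); case: (fg a).
rewrite -si; apply: eq_bigr => a _.
by rewrite !compA (chain0 _ (proj1 (fg a))).
Qed.

Definition natfam W (η : forall B, Mor (W ⊗ B) B) : Prop :=
  forall B B' (f : Mor B B'), f ∘ η B = η B' ∘ (W ◁ f).

Lemma natfam_ext W (η θ : forall B, Mor (W ⊗ B) B) :
  natfam η -> natfam θ -> (forall i, η (S i) = θ (S i)) -> forall B, η B = θ B.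
Proof.
move=> nη nθ eS B; have [n [c [inj [proj [_ si]]]]] := decomposition B.
rewrite -[η B]comp1m -[θ B]comp1m -si !comp_suml; apply: eq_bigr => a _.
by rewrite -!compA nη nθ eS.
Qed.

(** By Schur's lemma a map between these simple objects is 0 or a scalar, so any choice of
    components is natural on them. *)
Lemma simple_component_nat W (f : forall i, Mor (W ⊗ S i) (S i)) i j
    (g : Mor (S i) (S j)) :
  g ∘ f i = f j ∘ (W ◁ g).
Proof.
have [ij|nij] := eqVneq i j; last first.
  rewrite (simple_hom0 abC g) // ?comp0m ?tensm0 ?compm0 //.
  by move=> /S_inj/eqP; rewrite (negPf nij).
move: g; rewrite -ij => g; have [a ->] := simple_end abC g (S_simple i).
by rewrite tensZr tensm_id compZl compZr comp1m compm1.
Qed.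

(** The component at [B] is assembled from a decomposition of [B] into simple objects; [is_ext]
    expresses it without the decomposition, which yields naturality. *)
Lemma natfam_exists W (f : forall i, Mor (W ⊗ S i) (S i)) :
  exists η, natfam η /\ forall i, η (S i) = f i.
Proof.
pose is_ext B (η : Mor (W ⊗ B) B) :=
  forall i (g : Mor (S i) B), g ∘ f i = η ∘ (W ◁ g).
have ex_ext B : exists η, is_ext B η.
  have [n [c [inj [proj [_ si]]]]] := decomposition B.
  exists (\sum_a inj a ∘ f (c a) ∘ (W ◁ proj a)) => i g.
  rewrite comp_suml -[g in LHS]comp1m -si !comp_suml; apply: eq_bigr => a _.
  rewrite -[inj a ∘ proj a ∘ g]compA -compA (simple_component_nat f (proj a ∘ g)).
  by rewrite whiskl_comp !compA.
pose η B := sval (cid (ex_ext B)).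
have ηP B : is_ext B (η B) by rewrite /η; case: cid.
exists η; split=> [B B' g|i]; last first.
  by have := ηP (S i) i (idmor _); rewrite comp1m tensm_id compm1.
have [n [c [inj [proj [_ si]]]]] := decomposition B.
rewrite -[LHS]compm1 -[RHS]compm1 -tensm_id -si tens_sumr !comp_sumr.
apply: eq_bigr => a _; rewrite whiskl_comp !compA.
by rewrite -[g ∘ η B ∘ _]compA -ηP compA ηP whiskl_comp !compA.
Qed.

Lemma natfam_precomp W W' (η : forall B, Mor (W ⊗ B) B) (g : Mor W' W) :
  natfam η -> natfam (fun B => η B ∘ (g ▷ B)).
Proof. by move=> nη B B' f; rewrite compA nη -!compA whisk_exchange. Qed.

(** The action of [Y] on natural families, from which [transfer Y] arises by representability. *)
Definition pullback Y W (η : forall B, Mor (W ⊗ B) B) B : Mor (W ⊗ B) B :=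
  ptr (η (B ⊗ Y) ∘ assoc W B Y).

Lemma natfam_pullback Y W (η : forall B, Mor (W ⊗ B) B) :
  natfam η -> natfam (pullback Y η).
Proof.
move=> nη B B' f; rewrite /pullback -ptr_natl compA nη -ptr_natr; congr ptr.
by rewrite -!compA assoc_nat.
Qed.

Lemma cup_whisk B X X' Y (β : Mor (X ⊗ Y) X') :
  ((B ◁ β) ▷ dual Y) ∘ (assoc B X Y ▷ dual Y) ∘ cup Y (B ⊗ X) =
  assocV B X' (dual Y) ∘ (B ◁ ((β ▷ dual Y) ∘ cup Y X)).
Proof.
rewrite whiskl_comp compA assocV_nat -cop_tens !compA.
by rewrite (chain0 _ (assocV_assoc _ _ _)).
Qed.

(** Pure coherence: a pentagon and the triangle gather all that happens to the right of [A] under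
    one whiskering. *)
Lemma cap_whisk A X Y Z (β : Mor X (Y ⊗ Z)) :
  (cap Y A ▷ Z) ∘ assocV (A ⊗ dual Y) Y Z ∘ ((A ⊗ dual Y) ◁ β) =
  (A ◁ (lunit Z ∘ (ev Y ▷ Z) ∘ assocV (dual Y) Y Z ∘ (dual Y ◁ β)))
  ∘ assoc A (dual Y) X.
Proof.
rewrite kapE !whiskr_comp !whiskl_comp -(chain2 _ (assoc_natr _ _ _)).
rewrite -(triangleV A Z) (chain2 _ (assocV_nat _ _ _)); congr (_ ∘ _).
rewrite -!compA; congr (_ ∘ (_ ∘ _)); apply: assoc_epi; apply: assoc_mono.
rewrite (chain0 _ (assocV_assoc _ _ _)) !compA assoc_assocV comp1m.
by rewrite -[RHS]compA -pentagon !compA -whiskl_comp assocV_assoc tensm_id comp1m.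
Qed.

(** By the adjunction [u] corresponds to a pairing [𝟙 ⊗ Y -> 𝟙], hence to a map from [Y] to the
    unit. *)
Lemma hom_unit_dual0 Y (u : Mor 𝟙 (dual Y)) : (forall f : Mor Y 𝟙, f = 0) -> u = 0.
Proof.
move=> Y0; apply: whiskl1_inj; rewrite tensm0; apply: cap_epi.
rewrite -kap_slidel tens0m compm0 kapE.
rewrite -[_ ∘ (u ▷ Y)]compm1 -(lunitV_lunit Y) compA (Y0 (_ ∘ lunitV Y)).
by rewrite comp0m tensm0 compm0 comp0m.
Qed.

(** The closed diagram can be cut along a strand [dual Y]: closing [dual X] first leaves a morphism
    from the unit to [dual Y], which vanishes by [hom_unit_dual0]. *)
Lemma tr_rotated_pairing X Y (α : Mor X (X ⊗ Y)) (β : Mor (X ⊗ Y) X) :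
  (forall f : Mor Y 𝟙, f = 0) ->
  tr ((ptr (α ∘ cap X X ∘ ((X ⊗ dual X) ◁ β) ∘ assoc (X ⊗ dual X) X Y) ▷ dual X)
      ∘ cup X (X ⊗ dual X)) = 0.
Proof.
(* [κ] takes up [α] and [θ] takes up [β]; the strand of type [dual Y] that joins them comes from
   opening the loop of [Y]. *)
move=> Y0; pose κ := kap (cocap p Y) X ∘ (α ▷ dual Y).
pose θ := lunit (dual Y) ∘ (ev X ▷ dual Y) ∘ assocV (dual X) X (dual Y)
  ∘ (dual X ◁ ((β ▷ dual Y) ∘ cup Y X)).
have -> : ptr (α ∘ cap X X ∘ ((X ⊗ dual X) ◁ β) ∘ assoc (X ⊗ dual X) X Y) =
    κ ∘ (X ◁ θ) ∘ assoc X (dual X) X.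
  rewrite ptrE !whiskr_comp !compA (chain32 _ (cup_whisk _ _)).
  by rewrite (chain32 _ (cap_whisk _ _)).
clearbody κ θ.
rewrite !whiskr_comp (chain32 _ (cup_whisk _ _)) tr_ptr -compA ptr_natl.
set b := _ ∘ cup X (dual X).
(* Inserting a unit turns [b] into a map [𝟙 ⊗ dual X -> dual Y ⊗ dual X], whose partial trace over
   [dual X] starts at the unit. *)
have -> : X ◁ b = (X ◁ (b ∘ lunit _)) ∘ assoc X 𝟙 (dual X) ∘ (runitV X ▷ dual X).
  rewrite -compA assoc_runitV -whiskl_comp -compA.
  by rewrite lunit_lunitV compm1.
rewrite !compA ptr_natr ptr_tens (hom_unit_dual0 (ptr _) Y0).
by rewrite tensm0 comp0m compm0 tr0.
Qed.

(** * The representing object [M] with its universal family [ε], and the endomorphisms induced on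
    it *)

Section Representing.
Variables (M : C) (j : forall i, Mor (S i ⊗ dual (S i)) M)
  (π : forall i, Mor M (S i ⊗ dual (S i))).
Hypotheses (πj : forall i, π i ∘ j i = idmor _)
  (πj0 : forall i k, i != k -> π k ∘ j i = 0)
  (jπ : \sum_i j i ∘ π i = idmor M).
Variable ε : forall B, Mor (M ⊗ B) B.
Hypotheses (natε : natfam ε)
  (εS : forall i, ε (S i) = cap (S i) (S i) ∘ (π i ▷ S i)).

Lemma representing_inj W (t t' : Mor W M) :
  (forall B, ε B ∘ (t ▷ B) = ε B ∘ (t' ▷ B)) -> t = t'.
Proof.
move=> ett'; rewrite -[t]comp1m -[t']comp1m -jπ !comp_suml; apply: eq_bigr => i _.
rewrite -!compA; congr (_ ∘ _); apply: cap_epi.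
by rewrite !whiskr_comp !compA -!εS.
Qed.

(** The component of [t] at [i] is the transpose of [η (S i)]; agreement on simple objects suffices
    by [natfam_ext]. *)
Lemma representing_surj W (η : forall B, Mor (W ⊗ B) B) : natfam η ->
  exists t : Mor W M, forall B, ε B ∘ (t ▷ B) = η B.
Proof.
move=> nη; pose t i := (η (S i) ▷ dual (S i)) ∘ cup (S i) W.
exists (\sum_i j i ∘ t i); apply: natfam_ext (natfam_precomp _ natε) nη _ => i.
have πt : π i ∘ (\sum_k j k ∘ t k) = t i.
  rewrite comp_sumr (bigD1 i) //= compA πj comp1m big1 ?addr0 // => k ki.
  by rewrite compA πj0 // comp0m.
rewrite εS -compA -whiskr_comp πt /t whiskr_comp compA kap_nat.
by rewrite (chain0 _ (zigzag _ _)).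
Qed.

Definition transfer Y : Mor M M :=
  sval (cid (representing_surj (natfam_pullback Y natε))).

Lemma transferE Y B : ε B ∘ (transfer Y ▷ B) = ptr (ε (B ⊗ Y) ∘ assoc M B Y).
Proof. by rewrite /transfer; case: cid. Qed.

(** Closing [Z ⊗ Y] means closing [Y] and then [Z]; naturality of [ε] and a pentagon match the
    brackets. *)
Lemma transfer_comp Z Y : transfer Z ∘ transfer Y = transfer (Z ⊗ Y).
Proof.
apply: representing_inj => B; rewrite whiskr_comp compA !transferE ptr_tensor.
rewrite -ptr_natr; congr ptr; rewrite -compA assoc_natl compA transferE -ptr_natr.
congr ptr; rewrite !compA natε -(chain32 _ (pentagon _ _ _ _)) -!compA.
congr (_ ∘ _).
by rewrite !compA -whiskl_comp assocV_assoc tensm_id comp1m.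
Qed.

(** The identity of [Y], written as a sum, is inserted into the loop; each [proj a] slides round it
    and meets [inj a], leaving a loop of [X a]. *)
Lemma transfer_sum (J : finType) (X : J -> C) Y (inj : forall a, Mor (X a) Y)
    (proj : forall a, Mor Y (X a)) :
  (forall a, proj a ∘ inj a = idmor (X a)) ->
  \sum_a inj a ∘ proj a = idmor Y ->
  transfer Y = \sum_a transfer (X a).
Proof.
move=> pi_id si; apply: representing_inj => B.
rewrite tens_suml comp_sumr transferE -[_ ∘ assoc _ _ _]comp1m -tensm_id -si.
rewrite tens_sumr comp_suml ptr_sum.
apply: eq_bigr => a _; rewrite transferE whiskl_comp -compA -ptr_cyclic.
congr ptr; rewrite !compA natε (chain2 _ (assoc_natr _ _ _)).
by rewrite (chain0 _ (whiskl_inv _ (whiskl_inv _ (pi_id a)))).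
Qed.

Lemma transfer_unit : transfer 𝟙 = idmor M.
Proof.
apply: representing_inj => B; rewrite transferE tensm_id compm1 ptr_one.
rewrite !compA natε (chain1 _ (esym (runit_tens _ _))).
by rewrite (chain0 _ (runit_runitV _)).
Qed.

(** On the summand of [M] indexed by [i], decompose [S i ⊗ Y] into simple objects. Summands of
    another type drop out by orthogonality of the [π] and [j], and the others contribute traces
    killed by [tr_rotated_pairing]. *)
Lemma tr_transfer Y : (forall f : Mor Y 𝟙, f = 0) -> tr (transfer Y) = 0.
Proof.
move=> Y1; rewrite -[transfer Y]compm1 -jπ comp_sumr tr_sum big1 // => i _.
rewrite compA trC compA; set t := _ ∘ j i.
(* By adjunction [t] is recovered from its pairing with [S i], which is a partial trace of [ε]. *)
have -> : t = (ptr (ε (S i ⊗ Y) ∘ (j i ▷ (S i ⊗ Y)) ∘ assoc _ _ _) ▷ dual (S i))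
    ∘ cup (S i) (S i ⊗ dual (S i)).
  apply: cap_epi; rewrite /t !whiskr_comp !compA -εS transferE -ptr_natr.
  rewrite kap_nat (chain0 _ (zigzag _ _)); congr ptr.
  by rewrite -!compA assoc_natl.
have nη := natfam_precomp (j i) natε.
have [n [c [inj [proj [_ si]]]]] := decomposition (S i ⊗ Y).
have -> : ε (S i ⊗ Y) ∘ (j i ▷ (S i ⊗ Y)) =
    \sum_a inj a ∘ cap _ _ ∘ ((π (c a) ∘ j i) ▷ S (c a)) ∘ (_ ◁ proj a).
  rewrite -[LHS]comp1m -[X in X ∘ _]si comp_suml; apply: eq_bigr => a _.
  by rewrite -compA nη εS whiskr_comp !compA.
rewrite comp_suml ptr_sum tens_suml comp_suml tr_sum.
apply: big1 => a _.
have [ci|nci] := eqVneq (c a) i; last first.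
  rewrite πj0 1?eq_sym // tens0m compm0 !comp0m.
  by rewrite ptr0 tens0m comp0m tr0.
move: (inj a) (proj a); rewrite ci => α β.
rewrite πj tensm_id compm1; exact: tr_rotated_pairing.
Qed.

End Representing.

Lemma adjoint_transfer : exists (M : C) (T : C -> Mor M M),
  [/\ dim M = \sum_i dim (S i) * dim (dual (S i)),
      forall Z Y, T Z ∘ T Y = T (Z ⊗ Y),
      forall (J : finType) (X : J -> C) Y, is_direct_sum X Y -> T Y = \sum_a T (X a),
      T 𝟙 = idmor M
    & forall Y, (forall f : Mor Y 𝟙, f = 0) -> tr (T Y) = 0].
Proof.
have [M [j [π [πj πj0 jπ]]]] := direct_sum_exists abC (fun i => S i ⊗ dual (S i)).
have [ε [natε εS]] := natfam_exists (fun i => cap (S i) (S i) ∘ (π i ▷ S i)).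
exists M, (transfer πj πj0 natε εS); split.
- by rewrite (dim_sum _ _ _ πj jπ); apply: eq_bigr => i _; exact: dim_tens.
- by move=> Z Y; exact: transfer_comp.
- by move=> J X Y [inj [proj [pi_id _ si]]]; exact: transfer_sum pi_id si.
- exact: transfer_unit.
- by move=> Y; exact: tr_transfer.
Qed.

End AdjointObject.

(** * Roots of unity and a parity obstruction *)

Lemma sum_option (R : nmodType) (J : finType) (F : option J -> R) :
  \sum_x F x = F None + \sum_y F (Some y).
Proof.
rewrite (bigD1 None) //=; congr (_ + _).
rewrite (reindex_omap Some id) /=; first by apply: eq_bigl => y; rewrite eqxx.
by case.
Qed.

(** Any root of [1 + x + ... + x^(k-1)] serves, as this polynomial divides [x^k - 1]. *)
Lemma closed_root_of_unity_sum (K : closedFieldType) k :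
  (1 < k)%N -> exists ω : K, ω ^+ k = 1 /\ \sum_(i < k) ω ^+ i = 0.
Proof.
move=> k_gt1; have /closed_rootP[ω]: size (\poly_(i < k) (1 : K)) != 1%N.
  by rewrite size_poly_eq ?oner_neq0 // neq_ltn k_gt1 orbT.
rewrite /root horner_poly => /eqP ω_sum; exists ω.
have {}ω_sum : \sum_(i < k) ω ^+ i = 0.
  by rewrite -[RHS]ω_sum; apply: eq_bigr => i _; rewrite mul1r.
by split=> //; apply/eqP; rewrite -subr_eq0 subrX1 ω_sum mulr0.
Qed.

(** Eliminating [x^2] gives [z x = 2 y] with integers [y] and [z], where [z] is odd because [l c]
    is. The quadratic equation times [z^2] becomes [z^2 + 2 c z y = 4 y^2], which is impossible
    modulo 2. *)
Lemma odd_quadratic_irrational (F : numFieldType) (x : F) (c l a b : nat) :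
  odd c -> odd l -> x ^+ 2 = 1 + c%:R * x ->
  l%:R * (1 + x ^+ 2) = 2 * (a%:R + b%:R * x) -> False.
Proof.
move=> oddc oddl x2 eq_x.
pose y : int := a%:Z - l%:Z; pose z : int := (l * c)%:Z - b%:Z *+ 2.
have yE : y%:~R = a%:R - l%:R :> F by rewrite intrB -!pmulrn.
have zE : z%:~R = l%:R * c%:R - 2 * b%:R :> F.
  by rewrite intrB rmorphMn /= -!pmulrn natrM [2 * _]mulr_natl.
have zx : z%:~R * x = 2 * y%:~R.
  apply/eqP; rewrite -subr_eq0 yE zE; apply/eqP.
  transitivity (l%:R * (1 + x ^+ 2) - 2 * (a%:R + b%:R * x)).
    by rewrite x2; ring.
  by rewrite eq_x subrr.
have {zx} : z ^+ 2 + (c%:Z * z * y) *+ 2 = (y ^+ 2) *+ 4.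
  apply: (@intr_inj F); rewrite intrD !rmorphMn !rmorphXn /= !intrM -pmulrn.
  have : z%:~R ^+ 2 + c%:R * z%:~R * (z%:~R * x) = (z%:~R * x) ^+ 2 :> F.
    by rewrite exprMn x2; ring.
  rewrite zx => e.
  transitivity (z%:~R ^+ 2 + c%:R * z%:~R * (2 * y%:~R) : F); first by ring.
  by rewrite e; ring.
rewrite /z; have [w ->] : exists w, (l * c)%N = w.*2.+1.
  exists (l * c)./2; have := odd_double_half (l * c); rewrite oddM oddl oddc; lia.
clearbody y; nia.
Qed.

(** * Dimensions in a quadratic category and fixed points of [tau] *)

Section QuadraticCategory.
Context {K : numClosedFieldType} {C : rigidcat K} {G : finGroupType}.
Local Notation "𝟙" := (unitob C).
Variables (tau : G -> G) (m : nat) (inv : G -> C) (rho : C).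
Hypothesis tauM : {morph tau : g h / (g * h)%g}.
Hypothesis fusionC : is_fusion C.
Variable p : pivotal_structure C.
Hypothesis sphericalC : is_spherical p.
Hypothesis inv_group : is_group_of_invertibles inv.
Hypotheses (inv_simple : forall g, simple_object (inv g))
  (invrho_simple : forall g, simple_object (inv g ⊗ rho))
  (invrho_inj : forall g h, inv g ⊗ rho ≅ inv h ⊗ rho -> g = h)
  (inv_invrho : forall g h, ~ inv g ≅ inv h ⊗ rho)
  (simples : forall X : C, simple_object X ->
     (exists g, X ≅ inv g) \/ (exists g, X ≅ inv g ⊗ rho))
  (inv_rho : forall g, inv g ⊗ rho ≅ rho ⊗ inv (tau g))
  (rho_sqr : is_direct_sum
     (fun i : option (G * 'I_m) => if i is Some (g, _) then inv g ⊗ rho else 𝟙)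
     (rho ⊗ rho)).

Let abC : is_abelian C. Proof. by case: fusionC. Qed.
Let ssC : is_semisimple C. Proof. by case: fusionC. Qed.
Let simple1 : simple_object 𝟙. Proof. by case: fusionC. Qed.
Local Notation tr := (tr abC simple1 p).
Local Notation dim := (dim abC simple1 p).
Local Notation d := (dim rho).

Let invM g h : inv g ⊗ inv h ≅ inv (g * h)%g.
Proof. by case: inv_group. Qed.
Let inv_inj g h : inv g ≅ inv h -> g = h.
Proof. by case: inv_group => _ _ + _; apply. Qed.

(** The class [g] of the unit satisfies [g * g = g]. *)
Let inv1 : inv 1%g ≅ 𝟙.
Proof.
case: inv_group => _ all_inv _ _.
have unit_sqr : 𝟙 ⊗ 𝟙 ≅ 𝟙 by exists (lunit 𝟙), (lunitV 𝟙); exact: lunitK.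
have [|g g1] := all_inv 𝟙; first by exists 𝟙.
suff <- : g = 1%g by exact: iso_sym.
apply: (mulgI g); rewrite mulg1; apply: inv_inj.
apply: iso_trans (iso_sym (invM g g)) _; apply: iso_trans (iso_trans unit_sqr g1).
by apply: tens_iso; exact: iso_sym.
Qed.

Let inv_inverse g : inv g^-1%g ≅ dual (inv g).
Proof.
apply: dual_of_inverse => //; first by apply: iso_trans (invM _ _) _; rewrite mulgV.
by apply: iso_trans (invM _ _) _; rewrite mulVg.
Qed.

(** Sphericality gives [g] and its inverse the same dimension, which therefore squares to 1; its
    power of odd exponent [#|G|] is also 1. *)
Lemma dim_inv g : odd #|G| -> dim (inv g) = 1.
Proof.
have dimM x y : dim (inv (x * y)%g) = dim (inv x) * dim (inv y).
  by rewrite -dim_tens; apply: dim_iso; exact: iso_sym.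
have dim1 : dim (inv 1%g) = 1 by rewrite (dim_iso _ _ _ inv1) dim_unit.
have dimX n : dim (inv (g ^+ n)%g) = dim (inv g) ^+ n.
  by elim: n => [|n IHn]; rewrite ?expg0 // expgS dimM IHn exprS.
have sqr1 : dim (inv g) ^+ 2 = 1.
  rewrite expr2 -[X in _ * X](dim_dual abC simple1 _ sphericalC).
  by rewrite -(dim_iso _ _ _ (inv_inverse g)) -dimM mulgV.
have gX : (g ^+ #|G|)%g = 1%g.
  by rewrite -cardsT expg_cardG ?inE.
move=> oddG; have := dimX #|G|; rewrite gX dim1.
by rewrite -(odd_double_half #|G|) oddG -muln2 mulnC exprD exprM sqr1 expr1n mulr1.
Qed.

Let S (i : bool * G) : C := if i.1 then inv i.2 ⊗ rho else inv i.2.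

Let S_simple i : simple_object (S i).
Proof. by case: i => -[] g; [exact: invrho_simple | exact: inv_simple]. Qed.
Let S_inj i j : S i ≅ S j -> i = j.
Proof.
case: i j => [[] g] [[] h]; rewrite /S /=.
- by move=> gh; rewrite (invrho_inj gh).
- by move=> gh; case: (inv_invrho (iso_sym gh)).
- by move=> gh; case: (inv_invrho gh).
- by move=> gh; rewrite (inv_inj gh).
Qed.
Let S_all X : simple_object X -> exists i, X ≅ S i.
Proof. by move=> /simples[] [g Xg]; [exists (false, g) | exists (true, g)]. Qed.

Section OddOrder.
Hypothesis oddG : odd #|G|.

Let dim_S i : dim (S i) = if i.1 then d else 1.
Proof. by case: i => -[] g; rewrite /S /= ?dim_tens ?dim_inv ?mul1r. Qed.

Lemma dim_rho_sqr : d ^+ 2 = 1 + (#|G| * m)%:R * d.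
Proof.
have [inj [proj [pi_id _ si]]] := rho_sqr.
rewrite expr2 -dim_tens (dim_sum _ _ _ pi_id si) sum_option dim_unit; congr (_ + _).
rewrite (eq_bigr (fun=> d)) => [|[g l] _]; last by rewrite dim_tens dim_inv ?mul1r.
by rewrite sumr_const card_prod card_ord mulr_natl.
Qed.

Lemma dim_integral B : exists a b : nat, dim B = a%:R + b%:R * d.
Proof.
have [n [c [inj [proj [pi_id si]]]]] := decomposition ssC S_all B.
rewrite (dim_sum _ _ _ pi_id si).
apply: (big_ind (fun x => exists a b : nat, x = a%:R + b%:R * d)).
- by exists 0%N, 0%N; rewrite mul0r addr0.
- move=> _ _ [a [b ->]] [a' [b' ->]]; exists (a + a')%N, (b + b')%N.
  by rewrite !natrD mulrDl addrACA.
- move=> i _; rewrite dim_S; case: (c i).1; last first.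
    by exists 1%N, 0%N; rewrite mul0r addr0.
  by exists 0%N, 1%N; rewrite add0r mul1r.
Qed.

Lemma fixed_point_trivial h : odd m -> tau h = h -> h = 1%g.
Proof.
move=> oddm tau_h; apply/eqP/negP => /negP h1.
pose k := #[h]%g.
have k_gt1 : (1 < k)%N by rewrite order_gt1.
have [ω [ωk ω_sum]] := closed_root_of_unity_sum K k_gt1.
have [M [T [dimM TM T_sum T1 tr_T]]] :=
  adjoint_transfer abC simple1 ssC p S_simple S_inj S_all.
have T_iso X Y : X ≅ Y -> T X = T Y.
  move=> [f [g [gf fg]]]; rewrite (T_sum unit (fun _ => X) Y); last first.
    exists (fun _ => f), (fun _ => g); split=> [_|[] []|] //.
    by rewrite big_const card_unit /= addr0.
  by rewrite big_const card_unit /= addr0.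
pose Ug g := T (inv g); pose V := T rho; pose N := \sum_(g : G) Ug g.
have UgM g g' : Ug (g * g')%g = Ug g ∘ Ug g'.
  by rewrite /Ug TM; apply: T_iso; exact: iso_sym.
have Ug1 : Ug 1%g = idmor M by rewrite /Ug (T_iso _ _ inv1).
have trUg g : g != 1%g -> tr (Ug g) = 0.
  move=> g1; apply: tr_T => f; apply: (simple_hom0 abC) => // g_unit.
  by case/eqP: g1; apply: inv_inj; apply: iso_trans g_unit (iso_sym inv1).
have trUgV g : tr (Ug g ∘ V) = 0.
  rewrite TM; apply: tr_T => f; apply: (simple_hom0 abC) => // g_unit.
  by apply: (@inv_invrho 1%g g); apply: iso_trans inv1 (iso_sym g_unit).
pose U i := Ug (h ^+ i)%g.
have tau_hX i : tau (h ^+ i)%g = (h ^+ i)%g.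
  elim: i => [|i IHi]; last by rewrite expgS tauM tau_h IHi.
  by rewrite expg0; apply: (mulgI (tau 1%g)); rewrite -tauM !mulg1.
have UV i : U i ∘ V = V ∘ U i.
  by rewrite !TM; apply: T_iso; rewrite -{2}tau_hX; exact: inv_rho.
have UN i : U i ∘ N = N.
  rewrite /N comp_sumr [RHS](reindex_inj (mulgI (h ^+ i)%g)) /=.
  by apply: eq_bigr => g _; rewrite UgM.
have VV : V ∘ V = idmor M + m%:R *: (N ∘ V).
  rewrite TM (T_sum _ _ _ rho_sqr) sum_option T1; congr (_ + _).
  rewrite (eq_bigr (fun x : G * 'I_m => T (inv x.1 ⊗ rho))) => [|[] //].
  rewrite -(pair_bigA _ (fun g (_ : 'I_m) => T (inv g ⊗ rho))) /=.
  rewrite /N comp_suml scaler_sumr; apply: eq_bigr => g _.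
  by rewrite sumr_const card_ord scaler_nat TM.
have k0 : 2 * k%:R != 0 :> K by rewrite -natrM pnatr_eq0 muln_eq0 /= -lt0n order_gt0.
have Uk : U k = idmor M by rewrite /U expg_order.
have U0 : U 0%N = idmor M by [].
have UD i j : U (i + j)%N = U i ∘ U j by rewrite /U expgD UgM.
have qq := averaging_idempotent U0 UD Uk UV UN VV ωk ω_sum k0.
move: qq; set q := _ *: _ => qq.
(* Only the term [i = 0] without [V] has a trace: [h^i] is non-trivial for [0 < i < k], and
   [Ug g ∘ V] comes from a simple object other than the unit. [Ordinal (ltnW k_gt1)] is the index
   0. *)
have trq : tr q = (2 * k%:R)^-1 * dim M.
  rewrite /q trZ compDr compm1 trD; congr (_ * _).
  have -> : tr (average U k ω ∘ V) = 0.
    rewrite /average comp_suml tr_sum big1 // => i _.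
    by rewrite compZl trZ trUgV mulr0.
  rewrite addr0 /average tr_sum (bigD1 (Ordinal (ltnW k_gt1))) //= big1 => [|i i0].
    by rewrite expr0 scale1r U0 addr0.
  rewrite trZ trUg ?mulr0 // -order_dvdn gtnNdvd //.
  by rewrite lt0n; apply: contraNneq i0 => i0; apply/eqP/val_inj.
have [Q [i [r [ri ir]]]] := idempotent_split abC qq.
have [a [b dimQ]] := dim_integral Q.
have {}dimM : dim M = #|G|%:R * (1 + d ^+ 2).
  rewrite dimM (eq_bigr (fun i : bool * G => if i.1 then d ^+ 2 else 1)).
    rewrite -(pair_bigA _ (fun b (_ : G) => if b then d ^+ 2 else 1)) big_bool /=.
    by rewrite !sumr_const addrC mulrDr mulr1 mulr_natl.
  by move=> i' _; rewrite dim_dual // dim_S; case: i'.1; rewrite ?mulr1 ?expr2.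
have /dvdnP[l nE] : (k %| #|G|)%N by rewrite -cardsT order_dvdG ?inE.
(* The image [Q] has dimension [tr q], so this is [dim Q = (2 k)^-1 dim M] cleared of denominators,
   with [l = #|G| / k]. *)
have eq_d : l%:R * (1 + d ^+ 2) = 2 * (a%:R + b%:R * d).
  have k1 : k%:R != 0 :> K by rewrite pnatr_eq0 -lt0n order_gt0.
  apply: (mulfI k1); rewrite mulrA -natrM mulnC -nE -dimM mulrA -[_ * 2]mulrC.
  by rewrite -dimQ /dim -ri trC ir trq mulrA mulfV // mul1r.
have odd_l : odd l by move: oddG; rewrite nE oddM => /andP[].
apply: (@odd_quadratic_irrational K d (#|G| * m) l a b) => //.
- by rewrite oddM oddG.
- exact: dim_rho_sqr.
Qed.

End OddOrder.

End QuadraticCategory.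

(** If [g] and [h] have the same value of [g^-1 tau(g)], then [g h^-1] is fixed; so this map is
    injective, hence onto, and [tau] inverts each of its values. An inversion that is a morphism
    forces commutativity. *)
Lemma fixed_point_free_involution (G : finGroupType) (tau : G -> G) :
  {morph tau : g h / (g * h)%g} -> involutive tau ->
  (forall h, tau h = h -> h = 1%g) ->
  abelian [set: G] /\ (forall g, tau g = g^-1)%g.
Proof.
move=> tauM tauK tau_fix.
have tau1 : tau 1%g = 1%g by apply: (mulgI (tau 1%g)); rewrite -tauM !mulg1.
have tauV g : tau g^-1%g = (tau g)^-1%g.
  by apply: (mulgI (tau g)); rewrite -tauM !mulgV.
have inj_comm : injective (fun g => g^-1 * tau g)%g.
  move=> g h gh; apply/eqP; rewrite eq_mulgV1; apply/eqP/tau_fix.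
  apply: (mulgI g^-1%g); apply: (mulIg (tau h)).
  by rewrite tauM tauV !mulgA !mulgKV gh mulVg mul1g.
have tauI g : tau g = g^-1%g.
  have [f _ fK] := injF_bij inj_comm; rewrite -(fK g).
  by rewrite tauM tauV tauK invMg invgK.
split=> //; apply/centsP => g _ h _.
by apply: invg_inj; rewrite -tauI tauM !tauI invMg.
Qed.

Theorem theorem2p2 (R : realType) (G : finGroupType) (tau : G -> G) (m : nat)
    (tauM : {morph tau : g h / (g * h)%g}) (tauK : forall g, tau (tau g) = g)
    (C : rigidcat R[i]) (fusionC : is_fusion C)
    (p : pivotal_structure C) (sphericalC : is_spherical p)
    (quadC : is_quadratic C tau m) :
  odd #|G| -> odd m ->
  abelian [set: G] /\ (forall g : G, tau g = (g^-1)%g).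
Proof.
move=> oddG oddm; apply: fixed_point_free_involution => // h tau_h.
have [inv [rho [inv_group _ simples inv_rho sqr]]] := quadC.
have [sinv srho rho_inj inv_rho_neq all_s] := simples.
exact: (@fixed_point_trivial (R[i] : numClosedFieldType) C G tau m inv rho tauM
  fusionC p sphericalC inv_group sinv srho rho_inj inv_rho_neq all_s inv_rho sqr).
Qed.
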